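(* For every integer $k \geq 6$, \begin{align*} H^+(k+1,k) &= \left\{ 2^{k-1} + 2^{k-5} + 2^{k-6},~ 2^{k-1} + 2^{k-3},~ 2^{k-1} + 2^{k-2},~ 2^{k} \right\},\\ H^+(k+2,k) &= H^+(k+1,k) \cup\{ 2^{k-1} + 2^{k-4}\},\\ H^+(k+i,k) &= H^+(k+i-1,k)\cup \{ 2^{k-1} + 2^{k-(i+1)}\} \text{ for } i = 3, \dots, k-1,\\ H^+(k+i,k) &= H^+(2k-1,k) \text{ for all } i \geq k. \end{align*}
   Context: Let $\mathbb{H}^n=\{0,1\}^n\subseteq\mathbb{R}^n$. For $n\geq k$, $H(n,k)=\{\,|\mathbb{H}^k\cap L^{-1}(\mathbb{H}^{n-k})| : L:\mathbb{R}^k\to\mathbb{R}^{n-k}\text{ linear}\,\}$ (equivalently, the set of possible sizes of intersections of a $k$-dimensional linear subspace of $\mathbb{R}^n$ with $\mathbb{H}^n$), and $H^+(n,k)=H(n,k)\setminus\{1,\dots,2^{k-1}\}$. *)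

(* Defs.v *)
From HB Require Import structures.
From mathcomp Require Import all_boot all_order all_algebra.
From mathcomp Require Import reals.
Set Implicit Arguments. Unset Strict Implicit. Unset Printing Implicit Defensive.
Import Order.TTheory GRing.Theory Num.Theory.
Local Open Scope ring_scope.

(* A linear map L : R^k -> R^m is represented by a matrix L : 'M[R]_(k, m)
   acting on row vectors: x |-> x *m L.  A point of the cube H^k = {0,1}^k is
   encoded by b : {ffun 'I_k -> bool}, i.e. the row vector \row_i (b i)%:R. *)

Definition cube_preimage_card (R : realType) (k m : nat) (L : 'M[R]_(k, m)) : nat :=
  #|[set b : {ffun 'I_k -> bool} |
      [forall j : 'I_m, (((\row_i ((b i : nat)%:R : R)) *m L) 0 j == 0)
                        || (((\row_i ((b i : nat)%:R : R)) *m L) 0 j == 1)]]|.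

(* H(n,k), as a predicate on nat (meaningful for n >= k). *)
Definition Hset (R : realType) (n k : nat) (s : nat) : Prop :=
  exists L : 'M[R]_(k, n - k), cube_preimage_card L = s.

Definition Hplus (R : realType) (n k : nat) (s : nat) : Prop :=
  Hset R n k s /\ ~ (1 <= s <= 2 ^ (k - 1))%N.

(* Main.v *)
Require Import Defs.
From mathcomp Require Import all_boot all_order all_algebra.
From mathcomp Require Import reals.
From mathcomp Require Import zify.

(* If more than half of the cube satisfies the constraints [<b, v_j> \in {0,1}],
   flipping one bit shows that every [v_j] has entries in [{0,1,-1}].  With [p]
   entries [1] and [q] entries [-1], a column alone leaves the fraction
   ['C(p+q+1, q+1) / 2^(p+q)], which exceeds [1/2] only if [p - q \in {0,1,2}] and
   [p + q <= 7].  One extra coordinate homogenizes such a constraint into: up to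
   signs, a subset of odd size 1, 3, 5 or 7 is split by [b] as evenly as possible.
   A finite computation with products of binomials then shows which families of
   such sets keep more than half of the points: a single set (3/4, 5/8, 35/64);
   two 3-sets meeting in at most one point, or a 3-set inside a 5-set (9/16); or
   a sunflower of [n] 3-sets through a common pair, which leaves
   [1/2 + 1/2^(n+1)] and needs [n] columns. *)

Set Implicit Arguments. Unset Strict Implicit. Unset Printing Implicit Defensive.
Import GRing.Theory Num.Theory.

(** * Counting subsets by the sizes of their traces on disjoint regions *)

Section Counting.
Variable T : finType.
Implicit Types (Y Z D G U R : {set T}).

(** Symmetric difference, used as a change of signs: applying [sd^~ G] flips the coordinates in the
    mask [G]. The boolean sum lets identities be settled by truth tables. *)
Definition sd Y G : {set T} := [set x | (x \in Y) (+) (x \in G)].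

Lemma in_sd Y G x : (x \in sd Y G) = (x \in Y) (+) (x \in G).
Proof. by rewrite inE. Qed.

Lemma sdK G : involutive (sd^~ G).
Proof. by move=> Y; apply/setP=> x; rewrite !in_sd -addbA addbb addbF. Qed.

Lemma card_sd (P : pred {set T}) G :
  #|[set Y | P (sd Y G)]| = #|[set Y | P Y]|.
Proof.
rewrite -(card_imset _ (inv_inj (sdK G))); congr #|pred_of_set _|.
apply/setP=> Y; rewrite inE; apply/imsetP/idP => [[Z]|PY].
  by rewrite inE => PZ ->.
by exists (sd Y G); rewrite ?sdK // inE sdK.
Qed.

(* The sum of [prod_i 'C(r_i, c_i)] over the vectors [c] satisfying [P]: the
   number of subsets of a union of disjoint regions of sizes [rs] whose vector
   of traces' cardinals satisfies [P]. *)
Fixpoint wt (rs : seq nat) (P : seq nat -> bool) : nat :=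
  if rs is r :: rs' then
    sumn [seq 'C(r, c) * wt rs' (fun cs => P (c :: cs)) |
      c <- iota 0 r.+1]
  else P [::].

Lemma sum_subset_card R (f : nat -> nat) :
  \sum_(Y : {set T} | Y \subset R) f #|Y| =
  sumn [seq 'C(#|R|, c) * f c | c <- iota 0 #|R|.+1].
Proof.
rewrite sumnE big_map -[iota _ _]/(index_iota 0 #|R|.+1) big_mkord.
rewrite (partition_big (fun Y : {set T} => inord #|Y| : 'I_#|R|.+1) predT) //=.
apply: eq_bigr => c _.
rewrite (eq_bigl (fun Y => Y \in [set Y : {set T} | Y \subset R & #|Y| == c])); last first.
  move=> Y /=; rewrite inE; case: (boolP (Y \subset R)) => //= YR.
  by rewrite -val_eqE /= inordK // ltnS subset_leq_card.
rewrite (eq_bigr (fun=> f c)) => [|Y]; last by rewrite inE => /andP[_ /eqP ->].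
by rewrite sum_nat_const cards_draws.
Qed.

Lemma sum_subsetU U R (F : {set T} -> {set T} -> nat) : R \subset U ->
  \sum_(Y : {set T} | Y \subset U) F (Y :&: R) (Y :\: R) =
  \sum_(Y1 : {set T} | Y1 \subset R)
     \sum_(Y2 : {set T} | Y2 \subset U :\: R) F Y1 Y2.
Proof.
move=> RU; rewrite pair_big /=; apply: esym.
rewrite (reindex_onto (fun Y : {set T} => (Y :&: R, Y :\: R))
                      (fun p => p.1 :|: p.2)) /= => [|[Y1 Y2] /= /andP[s1]].
  apply: eq_bigl => Y; rewrite subsetIr setID eqxx andbT /=.
  apply/idP/idP => [YR|YU]; last exact: setSD.
  by rewrite -(setID Y R) subUset (subset_trans (subsetIr _ _) RU)
             (subset_trans YR (subsetDl _ _)).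
rewrite subsetD => /andP[_]; rewrite disjoint_sym disjoints_subset => s2.
congr pair; apply/setP=> x; move/subsetP/(_ x): s1; move/subsetP/(_ x): s2;
  rewrite !inE; case: (x \in Y1); case: (x \in Y2); case: (x \in R) => //=;
  by [move=> /(_ isT) | move=> _ /(_ isT)].
Qed.

Fixpoint disj_regions (Rs : seq {set T}) :=
  if Rs is R :: Rs' then all (fun R' => [disjoint R & R']) Rs' && disj_regions Rs'
  else true.

(** A subset [Y] splits into independent choices of [Y :&: R] and [Y :\: R]; the induction goes on
    inside [U :\: R], which is why the ambient set [U] is a parameter. Points outside all regions
    are free, and the powers of two account for them without division. *)
Lemma region_count_sub Rs U (P : seq nat -> bool) :
  disj_regions Rs -> all (fun R => R \subset U) Rs ->
  #|[set Y : {set T} | (Y \subset U) && P [seq #|R :&: Y| | R <- Rs]]| *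
    2 ^ sumn (map (fun R => #|R|) Rs) = 2 ^ #|U| * wt (map (fun R => #|R|) Rs) P.
Proof.
elim: Rs U P => [|R Rs IH] U P /=.
  move=> _ _; rewrite muln1; case: (P [::]); rewrite ?muln1 ?muln0.
    by rewrite -card_powerset; apply: eq_card => Y; rewrite !inE andbT.
  by apply: eq_card0 => Y; rewrite inE andbF.
case/andP=> dR dRs /andP[RU sU].
have dE R' : R' \in Rs -> [disjoint R & R'] by move=> ?; apply: (allP dR).
have sU' : all (fun R' => R' \subset U :\: R) Rs.
  apply/allP=> R' hR'; rewrite subsetD (allP sU) //=.
  by rewrite disjoint_sym dE.
pose F Y1 Y2 := P (#|Y1 : {set T}| :: [seq #|R' :&: Y2| | R' <- Rs]) : nat.
have -> : #|[set Y : {set T} | (Y \subset U) &&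
      P (#|R :&: Y| :: [seq #|R' :&: Y| | R' <- Rs])]|
   = \sum_(Y : {set T} | Y \subset U) F (Y :&: R) (Y :\: R).
  rewrite -sum1_card big_mkcond [RHS]big_mkcond /=; apply: eq_bigr => Y _.
  rewrite inE /F; case: (Y \subset U) => //=; rewrite setIC.
  have -> : [seq #|R' :&: Y| | R' <- Rs] = [seq #|R' :&: (Y :\: R)| | R' <- Rs].
    apply/eq_in_map => R' /dE; rewrite disjoint_sym -setI_eq0 => /eqP R0.
    congr #|pred_of_set _|; apply/setP=> x; move/setP/(_ x): R0; rewrite !inE.
    by case: (x \in R); case: (x \in R').
  by case: (P _).
rewrite (sum_subsetU _ RU).
pose f c := #|[set Y2 : {set T} | (Y2 \subset U :\: R) &&
                  P (c :: [seq #|R' :&: Y2| | R' <- Rs])]|.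
rewrite (eq_bigr (fun Y1 : {set T} => f #|Y1|)) => [|Y1 _]; last first.
  rewrite /f -sum1_card big_mkcond [RHS]big_mkcond /=; apply: eq_bigr => Y _.
  by rewrite inE; case: (_ \subset _) => //=; rewrite /F; case: (P _).
rewrite sum_subset_card.
have cU : 2 ^ #|U| = 2 ^ #|R| * 2 ^ #|U :\: R|.
  by rewrite -expnD -(cardsID R U) (setIidPr RU).
have -> : 'C(#|R|, 0) * wt [seq #|R0| | R0 <- Rs] (fun cs => P (0 :: cs)) +
   sumn [seq 'C(#|R|, c) * wt [seq #|R0| | R0 <- Rs] (fun cs => P (c :: cs)) |
      c <- iota 1 #|R|] =
   sumn [seq 'C(#|R|, c) * wt [seq #|R0| | R0 <- Rs] (fun cs => P (c :: cs)) |
      c <- iota 0 #|R|.+1].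
  by [].
rewrite !sumnE !big_map expnD cU -mulnA mulnCA; congr (_ * _).
rewrite big_distrl big_distrr /=; apply: eq_bigr => c _.
have /= IHc := IH (U :\: R) (fun cs => P (c :: cs)) dRs sU'.
rewrite sumnE big_map in IHc.
by rewrite -mulnA /f IHc mulnCA.
Qed.

Lemma region_count Rs (P : seq nat -> bool) : disj_regions Rs ->
  #|[set Y : {set T} | P [seq #|R :&: Y| | R <- Rs]]| *
    2 ^ sumn (map (fun R => #|R|) Rs) = 2 ^ #|T| * wt (map (fun R => #|R|) Rs) P.
Proof.
move=> dRs; rewrite -cardsT -region_count_sub //; last first.
  by apply/allP=> R _; apply: subsetT.
by congr (_ * _); apply: eq_card => Y; rewrite !inE subsetT.
Qed.

End Counting.

(** * Closed forms of some binomial weights *)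

Lemma sum_bin n : \sum_(i < n.+1) 'C(n, i) = 2 ^ n.
Proof. by rewrite -[2]/(1 + 1) expnDn; apply: eq_bigr => i _; rewrite !exp1n !muln1. Qed.

Lemma wt1E n (P : seq nat -> bool) :
  wt [:: n] P = \sum_(i < n.+1) 'C(n, i) * P [:: val i].
Proof. by rewrite -[RHS](big_mkord xpredT (fun i => 'C(n, i) * P [:: i])) /wt sumnE big_map. Qed.

Lemma sum_delta (f : nat -> nat) n q :
  (n <= q -> f q = 0) -> \sum_(i < n) f i * (i == q :> nat) = f q.
Proof.
move=> f0; have [qn|nq] := ltnP q n.
  rewrite (bigD1 (Ordinal qn)) //= eqxx muln1 big1 ?addn0 // => i.
  by rewrite -val_eqE /= => /negPf ->; rewrite muln0.
rewrite f0 // big1 // => i _; case: eqP => [e|]; last by rewrite muln0.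
by have := ltn_ord i; rewrite e ltnNge nq.
Qed.

(** Only the terms [q] and [q.+1] survive, and Pascal's rule merges them; for large [q] the
    binomials vanish on both sides. *)
Lemma wt_interval s q : wt [:: s] (fun cs => q <= head 0 cs <= q.+1) = 'C(s.+1, q.+1).
Proof.
rewrite wt1E /= binS -(sum_delta (f := fun i => 'C(s, i)) (n := s.+1)) => [|/bin_small //].
rewrite -[in RHS](sum_delta (f := fun i => 'C(s, i)) (n := s.+1) (q := q)) => [|/bin_small //].
rewrite -big_split /=; apply: eq_bigr => i _; rewrite -mulnDr; congr (_ * _).
by lia.
Qed.

(** [cI] and [cJ] count the core points and the petals at which a set differs from a reference
    solution that does not split the core. If one core point differs, the core becomes split and
    every 3-set is satisfied; otherwise all petals have to follow the core. *)
Definition sunflower_ok n (cs : seq nat) :=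
  if cs is [:: cI; cJ] then
    [|| cI == 1, (cI == 2) && (cJ == n) | (cI == 0) && (cJ == 0)]
  else false.

Lemma wt_sunflower n : wt [:: 2; n] (sunflower_ok n) = 2 * (2 ^ n + 1).
Proof.
have -> : wt [:: 2; n] (sunflower_ok n) =
   1 * wt [:: n] (fun cs => sunflower_ok n (0 :: cs)) +
     (2 * wt [:: n] (fun cs => sunflower_ok n (1 :: cs)) +
     (1 * wt [:: n] (fun cs => sunflower_ok n (2 :: cs)) + 0)).
  by [].
rewrite !wt1E /=.
rewrite [X in _ + (_ + (1 * X + _))](eq_bigr (fun i : 'I__ => 'C(n, i) * (i == n :> nat)));
  last by move=> i _; rewrite orbF.
rewrite !(sum_delta (f := fun i => 'C(n, i))) ?ltnn // bin0 binn.
rewrite (eq_bigr (fun i : 'I__ => 'C(n, i))) => [|i _]; last by rewrite muln1.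
by rewrite sum_bin; lia.
Qed.

(** Independent sets of a star: they avoid the centre or all the leaves. *)
Definition spokes_ok (cs : seq nat) :=
  if cs is [:: a; b] then (a == 0) || (b == 0) else false.

Lemma wt_spokes n : wt [:: 1; n] spokes_ok = 2 ^ n + 1.
Proof.
have -> : wt [:: 1; n] spokes_ok = 1 * wt [:: n] (fun cs => spokes_ok (0 :: cs)) +
     (1 * wt [:: n] (fun cs => spokes_ok (1 :: cs)) + 0) by [].
rewrite !wt1E /= (sum_delta (f := fun i => 'C(n, i))) // bin0.
rewrite (eq_bigr (fun i : 'I__ => 'C(n, i))) => [|i _]; last by rewrite muln1.
by rewrite sum_bin !mul1n addn0.
Qed.

(** * Finite computations on pairs and triples of constraints *)

Definition near_half s c := s./2 <= c <= s./2.+1.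

(* Two signed sets of supports [D1], [D2]: [ia] (resp. [id]) elements of
   [D1 :&: D2] have the same (resp. opposite) sign in both; [d1] and [d2] are the
   sizes of [D1 :\: D2] and [D2 :\: D1].  Counts are taken with the signs of [D1]
   on [D1], whence [id - cd] in the second constraint. *)
Definition pair_ok ia id d1 d2 (cs : seq nat) :=
  if cs is [:: ca; cd; c1; c2] then
    near_half (ia + id + d1) (ca + cd + c1) &&
    near_half (ia + id + d2) (ca + (id - cd) + c2)
  else false.

Definition pair_large ia id d1 d2 :=
  2 ^ sumn [:: ia; id; d1; d2] < 2 * wt [:: ia; id; d1; d2] (pair_ok ia id d1 d2).

(** Supports have at most 7 points, hence the ranges. The conclusion says that the signs agree or
    are opposite on the whole overlap, and that the supports are equal, or two 3-sets, or a 5-set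
    containing a 3-set. *)
Definition pair_check :=
  all (fun s1 => all (fun s2 => all (fun ia => all (fun id =>
   [&& s2 <= s1, ia + id <= s2 & pair_large ia id (s1 - (ia + id)) (s2 - (ia + id))] ==>
     ((ia == 0) || (id == 0)) &&
     [|| (s1 == s2) && (ia + id == s1), (s1 == 3) && (s2 == 3) |
         [&& s1 == 5, s2 == 3 & ia + id == 3]])
   (iota 0 8)) (iota 0 8)) [:: 3; 5; 7]) [:: 3; 5; 7].
Lemma pair_checked : pair_check. Proof. by vm_compute. Qed.

(* [r_{abc}] is the size of the cell of points lying in [D1], [D2], [D3] according
   to [a], [b], [c].  The signs agree on [D1 :&: D2] and [D1 :&: D3], and on the
   rest of [D2 :&: D3] they agree or are all opposite, as recorded by [e]. *)
Definition triple_ok (e : bool) r111 r110 r101 r011 r100 r010 r001 (cs : seq nat) :=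
  if cs is [:: c111; c110; c101; c011; c100; c010; c001] then
    [&& near_half (r111 + r110 + r101 + r100) (c111 + c110 + c101 + c100),
     near_half (r111 + r110 + r011 + r010) (c111 + c110 + c011 + c010) &
     near_half (r111 + r101 + r011 + r001)
      (c111 + c101 + (if e then r011 - c011 else c011) + c001)]
  else false.

Definition triple_large e r111 r110 r101 r011 r100 r010 r001 :=
  let rs := [:: r111; r110; r101; r011; r100; r010; r001] in
  2 ^ sumn rs < 2 * wt rs (triple_ok e r111 r110 r101 r011 r100 r010 r001).

(** [D2] and [D3] are 3-sets and [D1] has [s] points. Next to a 5-set the two 3-sets must coincide
    inside it; among three 3-sets two coincide or all three share exactly a pair. *)
Definition triple_check :=
  all (fun s => all (fun r111 => all (fun r110 => all (fun r101 => all (fun r011 => all (fun e =>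
   [&& r111 + r110 + r101 <= s, r111 + r110 + r011 <= 3, r111 + r101 + r011 <= 3 &
    triple_large e r111 r110 r101 r011 (s - (r111 + r110 + r101)) 
     (3 - (r111 + r110 + r011)) (3 - (r111 + r101 + r011))] ==>
   if s == 5 then r111 == 3 else
   [|| r111 + r110 == 3, r111 + r101 == 3, r111 + r011 == 3 | r111 == 2])
   [:: true; false]) (iota 0 4)) (iota 0 4)) (iota 0 4)) (iota 0 4)) [:: 3; 5].
Lemma triple_checked : triple_check. Proof. by vm_compute. Qed.
(** The configurations of weight 9/16: a 3-set inside a 5-set with equal or opposite signs, two
    disjoint 3-sets, and two 3-sets meeting in a point with opposite or equal signs. *)
Definition pair_value_check :=
  all (fun p : nat * nat * nat * nat => let: (ia, id, d1, d2) := p in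
     16 * wt [:: ia; id; d1; d2] (pair_ok ia id d1 d2) ==
      9 * 2 ^ sumn [:: ia; id; d1; d2])
   [:: (3,0,2,0); (0,3,2,0); (0,0,3,3); (0,1,2,2); (1,0,2,2)].
Lemma pair_value_checked : pair_value_check. Proof. by vm_compute. Qed.

(** * Signed sets and joint counts of two or three constraints *)

Section Constraints.
Variable T : finType.
Implicit Types (Y Z D G U R S : {set T}) (SS : {set {set T}}) (w : {set T} * {set T}).

(* [w] is a signed set: a support [w.1] and the set [w.2] of points with sign
   [-1], only [w.2 :&: w.1] being relevant.  For odd [#|w.1|] the constraint says
   that the signed sum of [Y], seen as a [+1/-1] vector, over [w.1] is [1] or [-1]. *)
Definition ok w Y := near_half #|w.1| #|w.1 :&: sd Y w.2|.

Lemma card_indicator (A : {set T}) : #|A| = \sum_x (x \in A).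
Proof.
by rewrite -sum1_card big_mkcond; apply: eq_bigr => x _; case: (x \in A).
Qed.

Lemma masked_region_count Rs G (P : seq nat -> bool) : disj_regions Rs ->
  #|[set Y : {set T} | P [seq #|R :&: sd Y G| | R <- Rs]]| *
    2 ^ sumn (map (fun R => #|R|) Rs) = 2 ^ #|T| * wt (map (fun R => #|R|) Rs) P.
Proof.
by move=> dRs; rewrite (card_sd (fun Y => P [seq #|R :&: Y| | R <- Rs])) region_count.
Qed.

Lemma single_count w :
  #|[set Y | ok w Y]| * 2 ^ #|w.1| =
    2 ^ #|T| * wt [:: #|w.1|] (fun cs => near_half #|w.1| (head 0 cs)).
Proof.
have /= := @masked_region_count [:: w.1] w.2 (fun cs => near_half #|w.1| (head 0 cs)) isT.
by rewrite addn0.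
Qed.

(** The complementary mask turns the count [c] into [#|D| - c], which exchanges the two middle
    values when [#|D|] is odd. *)
Lemma okC D G Y : odd #|D| -> ok (D, ~: G) Y = ok (D, G) Y.
Proof.
move=> oD; rewrite /ok /near_half /=.
have : #|D :&: sd Y (~: G)| + #|D :&: sd Y G| = #|D|.
  rewrite !card_indicator -big_split; apply: eq_bigr => x _ /=; rewrite !inE.
  by case: (x \in D); case: (x \in Y); case: (x \in G).
have : #|D| = (#|D|./2).*2.+1 by rewrite -[LHS]odd_double_half oD.
by lia.
Qed.

Lemma eq_ok D G G' Y : {in D, G =i G'} -> ok (D, G) Y = ok (D, G') Y.
Proof.
move=> eG; rewrite /ok /=; congr (near_half _ #|pred_of_set _|).
apply/setP=> x; rewrite !inE; case: (boolP (x \in D)) => //= xD.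
by rewrite (eG x xD).
Qed.

Lemma ok1 w Y : #|w.1| = 1 -> ok w Y.
Proof.
move=> w1; rewrite /ok w1 /near_half /=.
by rewrite -w1 subset_leq_card ?subsetIl.
Qed.

Lemma pair_count D1 G1 D2 G2 :
  let E := [set x | (x \in G1) == (x \in G2)] in
  let ia := #|D1 :&: D2 :&: E| in let id := #|D1 :&: D2 :\: E| in
  let d1 := #|D1 :\: D2| in let d2 := #|D2 :\: D1| in
  #|[set Y | ok (D1, G1) Y && ok (D2, G2) Y]| * 2 ^ sumn [:: ia; id; d1; d2] =
    2 ^ #|T| * wt [:: ia; id; d1; d2] (pair_ok ia id d1 d2).
Proof.
move=> E ia id d1 d2.
(* Counting needs one mask for both constraints: the signs of [D1] prevail on the overlap. *)
pose G := [set x | if x \in D1 then x \in G1 else x \in G2].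
pose Rs := [:: D1 :&: D2 :&: E; D1 :&: D2 :\: E; D1 :\: D2; D2 :\: D1].
have dRs : disj_regions Rs.
  by rewrite /= -!setI_eq0 !andbT; do ?[apply/andP; split]; apply/eqP/setP=> x;
    rewrite !inE; case: (x \in D1); case: (x \in D2);
    case: (x \in G1); case: (x \in G2).
rewrite -(masked_region_count G (pair_ok ia id d1 d2) dRs); congr (_ * _).
apply: eq_card => Y; rewrite !inE /ok /=.
have e1 : #|D1| = ia + id + d1.
  rewrite /ia /id /d1 !card_indicator -!big_split; apply: eq_bigr => x _ /=.
  by rewrite !inE; case: (x \in D1); case: (x \in D2);
    case: (x \in G1); case: (x \in G2).
have e2 : #|D2| = ia + id + d2.
  rewrite /ia /id /d2 !card_indicator -!big_split; apply: eq_bigr => x _ /=.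
  by rewrite !inE; case: (x \in D1); case: (x \in D2);
    case: (x \in G1); case: (x \in G2).
have c1 : #|D1 :&: sd Y G1| = #|D1 :&: D2 :&: E :&: sd Y G| +
    #|(D1 :&: D2 :\: E) :&: sd Y G| + #|(D1 :\: D2) :&: sd Y G|.
  rewrite !card_indicator -!big_split; apply: eq_bigr => x _ /=.
  by rewrite !inE; case: (x \in D1); case: (x \in D2); case: (x \in G1);
    case: (x \in G2); case: (x \in Y).
have c2 : #|D2 :&: sd Y G2| + #|(D1 :&: D2 :\: E) :&: sd Y G| =
    #|D1 :&: D2 :&: E :&: sd Y G| + id + #|(D2 :\: D1) :&: sd Y G|.
  rewrite /id !card_indicator -!big_split; apply: eq_bigr => x _ /=.
  by rewrite !inE; case: (x \in D1); case: (x \in D2); case: (x \in G1);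
    case: (x \in G2); case: (x \in Y).
have c3 : #|(D1 :&: D2 :\: E) :&: sd Y G| <= id by rewrite subset_leq_card ?subsetIl.
by rewrite e1 c1 {1}e2; congr (_ && near_half _ _); lia.
Qed.

Lemma triple_count D1 G1 D2 G2 D3 G3 e :
  {in D1 :&: D2, G1 =i G2} -> {in D1 :&: D3, G1 =i G3} ->
  {in (D2 :&: D3) :\: D1, forall x, (x \in G2) (+) (x \in G3) = e} ->
  let r111 := #|D1 :&: D2 :&: D3| in let r110 := #|D1 :&: D2 :\: D3| in
  let r101 := #|D1 :&: D3 :\: D2| in let r011 := #|D2 :&: D3 :\: D1| in
  let r100 := #|D1 :\: (D2 :|: D3)| in let r010 := #|D2 :\: (D1 :|: D3)| in
  let r001 := #|D3 :\: (D1 :|: D2)| in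
  let rs := [:: r111; r110; r101; r011; r100; r010; r001] in
  #|[set Y | [&& ok (D1, G1) Y, ok (D2, G2) Y & ok (D3, G3) Y]]| * 2 ^ sumn rs =
    2 ^ #|T| * wt rs (triple_ok e r111 r110 r101 r011 r100 r010 r001).
Proof.
move=> h12 h13 h23 r111 r110 r101 r011 r100 r010 r001 rs.
pose G := [set x | if x \in D1 then x \in G1 else if x \in D2 then x \in G2 else x \in G3].
pose Rs := [:: D1 :&: D2 :&: D3; D1 :&: D2 :\: D3; D1 :&: D3 :\: D2; D2 :&: D3 :\: D1;
   D1 :\: (D2 :|: D3); D2 :\: (D1 :|: D3); D3 :\: (D1 :|: D2)].
have dRs : disj_regions Rs.
  by rewrite /= -!setI_eq0 !andbT; do ?[apply/andP; split]; apply/eqP/setP=> x;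
    rewrite !inE; case: (x \in D1); case: (x \in D2); case: (x \in D3).
rewrite -(masked_region_count G (triple_ok e r111 r110 r101 r011 r100 r010 r001) dRs).
congr (_ * _); apply: eq_card => Y; rewrite !inE /ok /=.
have e1 : #|D1| = r111 + r110 + r101 + r100.
  rewrite /r111 /r110 /r101 /r100 !card_indicator -!big_split; apply: eq_bigr => x _ /=.
  by rewrite !inE; case: (x \in D1); case: (x \in D2); case: (x \in D3).
have e2 : #|D2| = r111 + r110 + r011 + r010.
  rewrite /r111 /r110 /r011 /r010 !card_indicator -!big_split; apply: eq_bigr => x _ /=.
  by rewrite !inE; case: (x \in D1); case: (x \in D2); case: (x \in D3).
have e3 : #|D3| = r111 + r101 + r011 + r001.
  rewrite /r111 /r101 /r011 /r001 !card_indicator -!big_split; apply: eq_bigr => x _ /=.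
  by rewrite !inE; case: (x \in D1); case: (x \in D2); case: (x \in D3).
have c1 : #|D1 :&: sd Y G1| = #|(D1 :&: D2 :&: D3) :&: sd Y G| +
   #|(D1 :&: D2 :\: D3) :&: sd Y G| + #|(D1 :&: D3 :\: D2) :&: sd Y G| +
   #|(D1 :\: (D2 :|: D3)) :&: sd Y G|.
  rewrite !card_indicator -!big_split; apply: eq_bigr => x _ /=.
  by rewrite !inE; case: (x \in D1); case: (x \in D2); case: (x \in D3);
    case: (x \in G1); case: (x \in Y).
have c2 : #|D2 :&: sd Y G2| = #|(D1 :&: D2 :&: D3) :&: sd Y G| +
   #|(D1 :&: D2 :\: D3) :&: sd Y G| + #|(D2 :&: D3 :\: D1) :&: sd Y G| +
   #|(D2 :\: (D1 :|: D3)) :&: sd Y G|.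
  rewrite !card_indicator -!big_split; apply: eq_bigr => x _ /=.
  move: (h12 x); rewrite !inE; case: (x \in D1); case: (x \in D2) => //=;
    by [move=> ->; case: (x \in D3); case: (x \in G2); case: (x \in Y)
       |move=> _; case: (x \in D3); case: (x \in G2); case: (x \in Y)
       |case: (x \in D3)].
have c3 : #|D3 :&: sd Y G3| = #|(D1 :&: D2 :&: D3) :&: sd Y G| +
   #|(D1 :&: D3 :\: D2) :&: sd Y G| +
   (if e then r011 - #|(D2 :&: D3 :\: D1) :&: sd Y G|
    else #|(D2 :&: D3 :\: D1) :&: sd Y G|) +
   #|(D3 :\: (D1 :|: D2)) :&: sd Y G|.
  (* On this cell the common mask is that of [D2], so opposite signs in [D3] complement the
     count. *)
  have -> : (if e then r011 - #|(D2 :&: D3 :\: D1) :&: sd Y G|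
    else #|(D2 :&: D3 :\: D1) :&: sd Y G|) = #|(D2 :&: D3 :\: D1) :&: sd Y G3|.
    case: e h23 => h23.
      have : #|(D2 :&: D3 :\: D1) :&: sd Y G3| + #|(D2 :&: D3 :\: D1) :&: sd Y G| = r011.
        rewrite /r011 !card_indicator -!big_split; apply: eq_bigr => x _ /=.
        move: (h23 x); rewrite !inE; case: (x \in D1); case: (x \in D2); case: (x \in D3) => //=.
        by move=> /(_ isT); case: (x \in G2); case: (x \in G3); case: (x \in Y).
      by lia.
    rewrite !card_indicator; apply: eq_bigr => x _ /=.
    move: (h23 x); rewrite !inE; case: (x \in D1); case: (x \in D2); case: (x \in D3) => //=.
    by move=> /(_ isT); case: (x \in G2); case: (x \in G3); case: (x \in Y).
  rewrite !card_indicator -!big_split; apply: eq_bigr => x _ /=.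
  move: (h13 x); rewrite !inE; case: (x \in D1); case: (x \in D3) => //=;
    rewrite ?andbF ?andbT //=;
    by [move=> /(_ isT) ->; case: (x \in D2); case: (x \in G3); case: (x \in Y)
       |move=> _; case: (x \in D2); case: (x \in G3); case: (x \in Y)
       |case: (x \in D2)].
by rewrite e1 e2 e3 c1 c2 c3.
Qed.

End Constraints.

(** * Which constraints can hold together on more than half of the points *)

Section Classification.
Variable T : finType.
Implicit Types (Y Z D G U R S : {set T}) (SS : {set {set T}}) (w : {set T} * {set T}).

Definition large SS := 2 ^ #|T| < 2 * #|SS|.

Lemma largeS SS SS' : SS \subset SS' -> large SS -> large SS'.
Proof. by move=> /subset_leq_card; rewrite /large; lia. Qed.

Lemma large_weight SS n v : #|SS| * 2 ^ n = 2 ^ #|T| * v -> large SS ->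
  2 ^ n < 2 * v.
Proof.
move=> e; rewrite /large -(ltn_pmul2r (expn_gt0 2 n)) -[2 * _ * _]mulnA e.
by rewrite mulnCA ltn_pmul2l ?expn_gt0.
Qed.

Definition small_size n := n \in [:: 3; 5; 7].

Lemma pair_checkP ia id s1 s2 : small_size s1 -> small_size s2 -> s2 <= s1 ->
  ia + id <= s2 -> pair_large ia id (s1 - (ia + id)) (s2 - (ia + id)) ->
  ((ia == 0) || (id == 0)) &&
     [|| (s1 == s2) && (ia + id == s1), (s1 == 3) && (s2 == 3) |
         [&& s1 == 5, s2 == 3 & ia + id == 3]].
Proof.
move=> m1 m2 le12 les2 lg.
have s27 : s2 <= 7 by move: m2; rewrite /small_size !inE; lia.
have /allP/(_ _ m1)/allP/(_ _ m2)/allP/(_ ia) := pair_checked.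
rewrite mem_iota => /(_ ltac:(lia))/allP/(_ id).
by rewrite mem_iota => /(_ ltac:(lia)); rewrite le12 les2 lg.
Qed.

(** The joint count depends only on the four cell sizes, so [pair_check] decides. If [ia] vanishes
    the signs are opposite on the whole overlap, if [id] vanishes they agree. *)
Lemma pair_large_sets SS w1 w2 : small_size #|w1.1| -> small_size #|w2.1| ->
  #|w2.1| <= #|w1.1| ->
  large SS -> SS \subset [set Y | ok w1 Y && ok w2 Y] ->
  (exists e, {in w1.1 :&: w2.1, forall x, (x \in w1.2) (+) (x \in w2.2) = e}) /\
  [|| (#|w1.1| == #|w2.1|) && (#|w1.1 :&: w2.1| == #|w1.1|), (#|w1.1| == 3) && (#|w2.1| == 3) |
      [&& #|w1.1| == 5, #|w2.1| == 3 & #|w1.1 :&: w2.1| == 3]].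
Proof.
case: w1 w2 => D1 G1 [D2 G2] /= m1 m2 le21 lS sub.
have := large_weight (pair_count D1 G1 D2 G2) (largeS sub lS).
set E := [set x | _]; set ia := #|_ :&: E|; set id := #|_ :\: E|.
have eI : #|D1 :&: D2| = ia + id by rewrite -(cardsID E).
have -> : #|D1 :\: D2| = #|D1| - (ia + id) by rewrite cardsD eI.
have -> : #|D2 :\: D1| = #|D2| - (ia + id) by rewrite cardsD setIC eI.
move/(pair_checkP m1 m2 le21); rewrite -eI {1}setIC subset_leq_card ?subsetIl //.
move=> /(_ isT) /andP[e ->]; split=> //.
case/orP: e; rewrite cards_eq0 => /eqP/setP e.
  exists true => x; move: (e x); rewrite !inE.
  by case: (x \in D1); case: (x \in D2); case: (x \in G1); case: (x \in G2).
exists false => x; move: (e x); rewrite !inE.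
by case: (x \in D1); case: (x \in D2); case: (x \in G1); case: (x \in G2).
Qed.

Lemma small_size_odd n : small_size n -> odd n.
Proof. by rewrite /small_size !inE => /or3P[] /eqP ->. Qed.

(* Complementing the mask of [w2] makes the two masks agree. *)
Lemma pair_normal SS w1 w2 : small_size #|w1.1| -> small_size #|w2.1| ->
  #|w2.1| <= #|w1.1| ->
  large SS -> SS \subset [set Y | ok w1 Y && ok w2 Y] ->
  exists2 G, ok (w2.1, G) =1 ok w2 & {in w1.1 :&: w2.1, w1.2 =i G}.
Proof.
move=> m1 m2 le21 lS sub.
have [[[] he] _] := pair_large_sets m1 m2 le21 lS sub; last first.
  exists w2.2; first by case: (w2).
  by move=> x /he; case: (x \in w1.2); case: (x \in w2.2).
exists (~: w2.2).
  by move=> Y; rewrite okC ?small_size_odd //; case: (w2).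
by move=> x /he; rewrite in_setC; case: (x \in w1.2); case: (x \in w2.2).
Qed.

(** On a common support the normalized masks agree everywhere, which leaves a single constraint. *)
Lemma pair_same SS w1 w2 : small_size #|w1.1| -> small_size #|w2.1| ->
  large SS -> SS \subset [set Y | ok w1 Y && ok w2 Y] ->
  w1.1 = w2.1 -> ok w2 =1 ok w1.
Proof.
move=> m1 m2 lS sub e12.
have le21 : #|w2.1| <= #|w1.1| by rewrite e12.
have [G e1 e2 Y] := pair_normal m1 m2 le21 lS sub.
rewrite -e1 -e12; case: (w1) e12 e2 => D G1 /= <-; rewrite setIid => e2.
by apply: eq_ok => x /e2.
Qed.

Lemma triple_checkP e s r111 r110 r101 r011 : s \in [:: 3; 5] ->
   r111 + r110 + r101 <= s -> r111 + r110 + r011 <= 3 -> r111 + r101 + r011 <= 3 ->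
    triple_large e r111 r110 r101 r011 (s - (r111 + r110 + r101)) 
     (3 - (r111 + r110 + r011)) (3 - (r111 + r101 + r011)) ->
   if s == 5 then r111 == 3 else
   [|| r111 + r110 == 3, r111 + r101 == 3, r111 + r011 == 3 | r111 == 2].
Proof.
move=> ms l1 l2 l3 lg.
have /allP/(_ _ ms)/allP/(_ r111) := triple_checked.
rewrite mem_iota => /(_ ltac:(lia))/allP/(_ r110).
rewrite mem_iota => /(_ ltac:(lia))/allP/(_ r101).
rewrite mem_iota => /(_ ltac:(lia))/allP/(_ r011).
rewrite mem_iota => /(_ ltac:(lia))/allP/(_ e).
by move=> /(_ ltac:(by case: (e))); rewrite l1 l2 l3 lg.
Qed.

(** The masks of [w2] and [w3] are normalized against that of [w1]. The signs still free, on the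
    part of [w2.1 :&: w3.1] outside [w1.1], reduce to one bit [e] by the result on pairs, and
    [triple_check] covers both values. *)
Lemma triple_large_sets SS w1 w2 w3 :
  #|w1.1| \in [:: 3; 5] -> #|w2.1| = 3 -> #|w3.1| = 3 -> large SS ->
  SS \subset [set Y | [&& ok w1 Y, ok w2 Y & ok w3 Y]] ->
  if #|w1.1| == 5 then #|w1.1 :&: w2.1 :&: w3.1| == 3 else
  [|| #|w1.1 :&: w2.1| == 3, #|w1.1 :&: w3.1| == 3, #|w2.1 :&: w3.1| == 3 |
      #|w1.1 :&: w2.1 :&: w3.1| == 2].
Proof.
move=> m1 s2 s3 lS sub.
have m1' : small_size #|w1.1|.
  by move: m1; rewrite /small_size !inE => /orP[] ->; rewrite ?orbT.
have s1 : 3 <= #|w1.1| by move: m1; rewrite !inE => /orP[] /eqP ->.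
have m2 : small_size #|w2.1| by rewrite s2.
have m3 : small_size #|w3.1| by rewrite s3.
have sb12 : SS \subset [set Y | ok w1 Y && ok w2 Y].
  by apply: subset_trans sub _; apply/subsetP=> Y; rewrite !inE => /and3P[-> ->].
have sb13 : SS \subset [set Y | ok w1 Y && ok w3 Y].
  by apply: subset_trans sub _; apply/subsetP=> Y; rewrite !inE => /and3P[-> _ ->].
have sb23 : SS \subset [set Y | ok w2 Y && ok w3 Y].
  by apply: subset_trans sub _; apply/subsetP=> Y; rewrite !inE => /and3P[_ -> ->].
have le21 : #|w2.1| <= #|w1.1| by rewrite s2.
have le31 : #|w3.1| <= #|w1.1| by rewrite s3.
have [G2 e2 h12] := pair_normal m1' m2 le21 lS sb12.
have [G3 e3 h13] := pair_normal m1' m3 le31 lS sb13.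
have sb23' : SS \subset [set Y | ok (w2.1, G2) Y && ok (w3.1, G3) Y].
  by apply: subset_trans sb23 _; apply/subsetP=> Y; rewrite !inE e2 e3.
have le32 : #|w3.1| <= #|w2.1| by rewrite s2 s3.
have [[e h23] _] := pair_large_sets (w1 := (w2.1, G2)) (w2 := (w3.1, G3)) m2 m3 le32 lS sb23'.
have h23' : {in (w2.1 :&: w3.1) :\: w1.1, forall x, (x \in G2) (+) (x \in G3) = e}.
  by move=> x /setDP[/h23].
have sub' : SS \subset [set Y | [&& ok (w1.1, w1.2) Y, ok (w2.1, G2) Y & ok (w3.1, G3) Y]].
  apply: subset_trans sub _; apply/subsetP=> Y; rewrite !inE e2 e3.
  by case: (w1).
have {h12 h13 h23 h23' sub'} := large_weight (triple_count h12 h13 h23') (largeS sub' lS).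
rewrite -[_ < _]/(triple_large _ _ _ _ _ _ _ _).
move: (w1.1) (w2.1) (w3.1) m1 s2 s3 => D1 D2 D3 m1 s2 s3.
set r111 := #|D1 :&: D2 :&: D3|; set r110 := #|D1 :&: D2 :\: D3|.
set r101 := #|D1 :&: D3 :\: D2|; set r011 := #|D2 :&: D3 :\: D1|.
have e12 : #|D1 :&: D2| = r111 + r110 by rewrite -(cardsID D3).
have e13 : #|D1 :&: D3| = r111 + r101.
  by rewrite -(cardsID D2) /r111 setIAC.
have e23 : #|D2 :&: D3| = r111 + r011.
  by rewrite -(cardsID D1) /r111 [_ :&: D1]setIC setIA.
have E1 : #|D1 :\: (D2 :|: D3)| + (r111 + r110 + r101) = #|D1|.
  rewrite /r111 /r110 /r101 !card_indicator -!big_split; apply: eq_bigr => x _ /=.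
  by rewrite !inE; case: (x \in D1); case: (x \in D2); case: (x \in D3).
have E2 : #|D2 :\: (D1 :|: D3)| + (r111 + r110 + r011) = 3.
  rewrite -s2 /r111 /r110 /r011 !card_indicator -!big_split; apply: eq_bigr => x _ /=.
  by rewrite !inE; case: (x \in D1); case: (x \in D2); case: (x \in D3).
have E3 : #|D3 :\: (D1 :|: D2)| + (r111 + r101 + r011) = 3.
  rewrite -s3 /r111 /r101 /r011 !card_indicator -!big_split; apply: eq_bigr => x _ /=.
  by rewrite !inE; case: (x \in D1); case: (x \in D2); case: (x \in D3).
have F1 : #|D1 :\: (D2 :|: D3)| = #|D1| - (r111 + r110 + r101) by rewrite -E1 addnK.
have F2 : #|D2 :\: (D1 :|: D3)| = 3 - (r111 + r110 + r011) by rewrite -E2 addnK.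
have F3 : #|D3 :\: (D1 :|: D2)| = 3 - (r111 + r101 + r011) by rewrite -E3 addnK.
rewrite F1 F2 F3 => lg; rewrite e12 e13 e23.
apply: (triple_checkP m1 _ _ _ lg).
- by rewrite -E1 leq_addl.
- by rewrite -E2 leq_addl.
- by rewrite -E3 leq_addl.
Qed.

Variables (m : nat) (F : 'I_m -> {set T} * {set T}).

Definition sols := [set Y | [forall j, ok (F j) Y]].

Lemma solsP Y : reflect (forall j, ok (F j) Y) (Y \in sols).
Proof. by rewrite inE; apply: forallP. Qed.

Hypothesis lF : large sols.

Lemma sols_pair i j : sols \subset [set Y | ok (F i) Y && ok (F j) Y].
Proof. by apply/subsetP=> Y /solsP h; rewrite inE !h. Qed.

Lemma sols_triple i j l : sols \subset [set Y | [&& ok (F i) Y, ok (F j) Y & ok (F l) Y]].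
Proof. by apply/subsetP=> Y /solsP h; rewrite inE !h. Qed.

Lemma sols_single j0 :
  (forall j, #|(F j).1| = 1 \/ (F j).1 = (F j0).1) -> small_size #|(F j0).1| ->
  sols = [set Y | ok (F j0) Y].
Proof.
move=> h s0; apply/setP=> Y; rewrite [RHS]inE; apply/solsP/idP => [->//|Y0 j].
have [/ok1 ->//|ej] := h j.
by rewrite (pair_same s0 _ lF (sols_pair j0 j)) ?ej.
Qed.

Lemma sols_double j0 j1 :
  (forall j, [\/ #|(F j).1| = 1, (F j).1 = (F j0).1 | (F j).1 = (F j1).1]) ->
  small_size #|(F j0).1| -> small_size #|(F j1).1| ->
  sols = [set Y | ok (F j0) Y && ok (F j1) Y].
Proof.
move=> h s0 s1; apply/setP=> Y; rewrite [RHS]inE; apply/solsP/idP => [hY|/andP[Y0 Y1] j].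
  by rewrite !hY.
have [/ok1 ->//|ej|ej] := h j.
  by rewrite (pair_same s0 _ lF (sols_pair j0 j)) ?ej.
by rewrite (pair_same s1 _ lF (sols_pair j1 j)) ?ej.
Qed.

(** The relative sign is constant on the overlap, so only the five configurations of
    [pair_value_check] can occur. *)
Lemma sols_double_count j0 j1 :
  (forall j, [\/ #|(F j).1| = 1, (F j).1 = (F j0).1 | (F j).1 = (F j1).1]) ->
  [&& #|(F j0).1| == 5, #|(F j1).1| == 3 & #|(F j0).1 :&: (F j1).1| == 3] ||
  [&& #|(F j0).1| == 3, #|(F j1).1| == 3 & #|(F j0).1 :&: (F j1).1| <= 1] ->
  16 * #|sols| = 9 * 2 ^ #|T|.
Proof.
move=> h hs.
have s0 : small_size #|(F j0).1| by case/orP: hs => /and3P[/eqP ->].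
have s1 : small_size #|(F j1).1| by case/orP: hs => /and3P[_ /eqP ->].
have le10 : #|(F j1).1| <= #|(F j0).1| by case/orP: hs => /and3P[/eqP -> /eqP ->].
have [[e he] _] := pair_large_sets s0 s1 le10 lF (sols_pair j0 j1).
have := pair_count (F j0).1 (F j0).2 (F j1).1 (F j1).2; cbv zeta.
rewrite -!surjective_pairing -(sols_double h s0 s1).
set E := [set x | (x \in (F j0).2) == (x \in (F j1).2)]; set ia := #|_ :&: E|; set id := #|_ :\: E|.
have eI : #|(F j0).1 :&: (F j1).1| = ia + id by rewrite -(cardsID E).
have -> : #|(F j0).1 :\: (F j1).1| = #|(F j0).1| - (ia + id) by rewrite cardsD eI.
have -> : #|(F j1).1 :\: (F j0).1| = #|(F j1).1| - (ia + id) by rewrite cardsD setIC eI.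
have ei0 : (ia == 0) || (id == 0).
  case: e he => he; [apply/orP; left | apply/orP; right];
    rewrite cards_eq0; apply/eqP/setP=> x; move: (he x); rewrite !inE;
    case: (x \in (F j0).1); case: (x \in (F j1).1); rewrite ?andbF //= => /(_ isT);
    by case: (x \in (F j0).2); case: (x \in (F j1).2).
set p := (ia, id, #|(F j0).1| - (ia + id), #|(F j1).1| - (ia + id)).
have hp : p \in [:: (3,0,2,0); (0,3,2,0); (0,0,3,3); (0,1,2,2); (1,0,2,2)].
  move: hs; rewrite eI /p => /orP[] /and3P[/eqP -> /eqP ->] ei.
    by case/orP: ei0 ei => /eqP ->; rewrite ?addn0 ?add0n => /eqP ->.
  by case: ia id ei0 ei {p he eI} => [|[|ia]] [|[|id]].
have /allP/(_ _ hp)/eqP := pair_value_checked.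
move=> e1 e2; apply/eqP; 
have := expn_gt0 2
  (sumn [:: ia; id; #|(F j0).1| - (ia + id); #|(F j1).1| - (ia + id)]).
move=> /eqn_pmul2r <-.
by rewrite -mulnA e2 mulnCA e1 mulnCA mulnA.
Qed.

End Classification.

(** * Sunflowers of 3-sets around a common pair *)

Lemma eq_set_cardI (T : finType) (A B : {set T}) n :
  #|A| = n -> #|B| = n -> #|A :&: B| = n -> A = B.
Proof.
move=> sA sB sAB; have eA : A :&: B = A by apply/eqP; rewrite eqEcard subsetIl sA sAB leqnn.
by apply/eqP; rewrite eqEcard sA sB leqnn andbT -eA subsetIr.
Qed.

Section Sunflower.
Variables (T : finType) (m : nat) (F : 'I_m -> {set T} * {set T}).
Implicit Types (Y Z D G U R S I J : {set T}).

Hypothesis sizeF : forall j, (#|(F j).1| == 1) || (#|(F j).1| == 3).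
Hypothesis lF : large (sols F).

Variables (j0 j1 : 'I_m).
Let I := (F j0).1 :&: (F j1).1.
Hypothesis (s0 : #|(F j0).1| = 3) (s1 : #|(F j1).1| = 3) (sI : #|I| = 2).

(** By the result on triples, a third 3-set equals one of the first two or meets their intersection
    [I] in two points, that is, in all of [I]. *)
Lemma core_sub j : #|(F j).1| = 3 -> I \subset (F j).1.
Proof.
move=> sj.
have m0 : #|(F j0).1| \in [:: 3; 5] by rewrite s0.
have := triple_large_sets m0 s1 sj lF (sols_triple F j0 j1 j).
rewrite s0 /= => /or4P[].
- by rewrite -/I sI.
- by move/eqP/(eq_set_cardI s0 sj) <-; rewrite subsetIl.
- by move/eqP/(eq_set_cardI s1 sj) <-; rewrite subsetIr.
rewrite -/I => sIj.
have <- : I :&: (F j).1 = I by apply/eqP; rewrite eqEcard subsetIl sI (eqP sIj).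
by rewrite subsetIr.
Qed.

(* Otherwise all solutions split the common pair, and these are only half. *)
Lemma mono_sol : exists2 Y0, Y0 \in sols F & #|I :&: sd Y0 (F j0).2| != 1.
Proof.
case: (boolP [exists Y in sols F, #|I :&: sd Y (F j0).2| != 1]).
  by case/exists_inP => Y h1 h2; exists Y.
rewrite negb_exists => /forallP h.
have sub : sols F \subset [set Y | (head 0 [seq #|R :&: sd Y (F j0).2| | R <- [:: I]]) == 1].
  by apply/subsetP=> Y hY; have := h Y; rewrite hY /= negbK inE.
have /= := masked_region_count (Rs := [:: I]) (F j0).2 (fun cs => head 0 cs == 1) isT.
by move/large_weight/(_ (largeS sub lF)); rewrite sI.
Qed.

Definition petals :=
  [set l | (l \notin I) && [exists j, (#|(F j).1| == 3) && (l \in (F j).1)]].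

Lemma card_petals : 2 <= #|petals| <= m.
Proof.
have sub j : #|(F j).1| = 3 -> #|(F j).1 :\: I| = 1.
  by move=> sj; have := core_sub sj; rewrite cardsD => /setIidPr ->; rewrite sj sI.
apply/andP; split.
  have /eqP/cards1P[x ex] := sub _ s0; have /eqP/cards1P[y ey] := sub _ s1.
  have hx : x \in (F j0).1 :\: I by rewrite ex inE.
  have hy : y \in (F j1).1 :\: I by rewrite ey inE.
  have xy : x != y.
    apply/eqP=> exy; move: hx hy; rewrite -exy !inE.
    by case: (x \in (F j0).1); case: (x \in (F j1).1).
  have <- : #|[set x; y]| = 2 by rewrite cards2 xy.
  apply: subset_leq_card; apply/subsetP=> z /set2P[] ->; rewrite inE.
    case/setDP: hx => hx -> /=; apply/existsP; exists j0; rewrite s0 hx //.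
  by case/setDP: hy => hy -> /=; apply/existsP; exists j1; rewrite s1 hy.
(* Each 3-set has a single point outside [I], so sending a column to that point covers all petals
   and bounds their number by [m]. *)
pose h (j : 'I_m) := [pick x in (F j).1 :\: I].
have injS : injective (@Some T) by move=> x y [].
rewrite -(card_imset _ injS) -[m]card_ord.
apply: leq_trans (leq_imset_card h predT).
apply: subset_leq_card; apply/subsetP=> _ /imsetP[l hl ->].
move: hl; rewrite inE => /andP[lI /existsP[j /andP[/eqP sj lj]]].
apply/imsetP; exists j => //; rewrite /h.
have /eqP/cards1P[x ex] := sub _ sj.
have := erefl (l \in (F j).1 :\: I); rewrite {2}in_setD lI lj ex inE /= => /eqP ->.
by case: pickP => [y|/(_ x)]; rewrite !inE ?eqxx // => /eqP ->.
Qed.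

(** For size 3 the middle values are 1 and 2, so the constraint becomes not-all-equal, which truth
    tables can handle. *)
Lemma near_half3 (D : {set T}) a b l : D = [set a; b; l] -> #|D| = 3 ->
  forall W : {set T}, near_half #|D| #|D :&: W| =
    ~~ (((a \in W) == (b \in W)) && ((b \in W) == (l \in W))).
Proof.
move=> eD sD W.
have : uniq [:: a; b; l].
  have -> : uniq [:: a; b; l] = (#|[:: a; b; l]| == 3) by apply/card_uniqP/eqP.
  apply/eqP; rewrite -sD eD; apply: eq_card => x; rewrite !inE.
  by rewrite orbA.
rewrite /= !inE negb_or andbT => /andP[/andP[ab al] bl].
have -> : #|D :&: W| = (a \in W) + (b \in W) + (l \in W).
  rewrite card_indicator (bigD1 a) // (bigD1 b) 1?eq_sym //= (bigD1 l) /=; last first.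
    by rewrite ![l == _]eq_sym al.
  rewrite big1 => [|x /andP[/andP[xa xb] xl]]; last first.
    by rewrite eD !inE (negPf xa) (negPf xb) (negPf xl).
  by rewrite eD !inE !eqxx ?orbT /= addn0 addnA.
by rewrite sD /near_half; case: (a \in W); case: (b \in W); case: (l \in W).
Qed.

(* Taking the solution [Y0] as origin makes all signs equal. *)
Lemma sunflower_sols Y0 : Y0 \in sols F -> #|I :&: sd Y0 (F j0).2| != 1 ->
  sols F = [set Y | sunflower_ok #|petals| [seq #|R :&: sd Y Y0| | R <- [:: I; petals]]].
Proof.
move=> hY0 mono.
have /eqP/cards2P[a [b [ab eI]]] := sI.
have aI : a \in I by rewrite eI !inE eqxx.
have bI : b \in I by rewrite eI !inE eqxx orbT.
have cardI W : #|I :&: W| = (a \in W) + (b \in W).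
  rewrite card_indicator (bigD1 a) // (bigD1 b) 1?eq_sym //=.
  rewrite big1 => [|x /andP[xa xb]]; last by rewrite eI !inE (negPf xa) (negPf xb).
  by rewrite (in_setI a I) (in_setI b I) aI bI addn0.
have {}mono : (a \in Y0) (+) (a \in (F j0).2) = (b \in Y0) (+) (b \in (F j0).2).
  by move: mono; rewrite cardI !in_sd; case: (_ (+) _); case: (_ (+) _).
(* In [Y0] the signed core is constant, so the petal [l] takes the opposite value. A set that leaves
   the core constant must therefore flip [l] exactly when it flips the core. *)
have key j l Y : #|(F j).1| = 3 -> (F j).1 = [set a; b; l] ->
  ok (F j) Y = [|| #|I :&: sd Y Y0| == 1, (#|I :&: sd Y Y0| == 2) && (l \in sd Y Y0)
     | (#|I :&: sd Y Y0| == 0) && (l \notin sd Y Y0)].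
  move=> sj ej.
  have m0 : small_size #|(F j0).1| by rewrite s0.
  have mj : small_size #|(F j).1| by rewrite sj.
  have lej : #|(F j).1| <= #|(F j0).1| by rewrite sj s0.
  have [[e he] _] := pair_large_sets m0 mj lej lF (sols_pair F j0 j).
  have /subsetP subI := core_sub sj.
  have ha := he a; have hb := he b; move: ha hb.
  rewrite !in_setI !subI //; move: (aI) (bI); rewrite !in_setI => /andP[-> _] /andP[-> _].
  move=> /(_ isT) ha /(_ isT) hb.
  have /solsP/(_ j) := hY0; rewrite /ok !(near_half3 ej sj) cardI !in_sd.
  move: mono ha hb.
  by case: (a \in Y0); case: (b \in Y0); case: (l \in Y0); case: (a \in (F j0).2);
     case: (b \in (F j0).2); case: e {he}; case: (a \in (F j).2); case: (b \in (F j).2);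
     case: (l \in (F j).2) => //=; case: (a \in Y); case: (b \in Y); case: (l \in Y).
have petalE j l : #|(F j).1| = 3 -> l \in (F j).1 -> l \notin I -> (F j).1 = [set a; b; l].
  move=> sj lj lI; apply/eqP; rewrite eq_sym eqEcard -eI subUset core_sub // sub1set lj /=.
  by rewrite setUC cardsU1 lI sI sj.
have cardJ (W : {set T}) : (#|petals :&: W| == #|petals|) = (petals \subset W).
  apply/eqP/idP => [h|/setIidPl -> //].
  by apply/setIidPl/eqP; rewrite eqEcard subsetIl h leqnn.
apply/setP=> Y; rewrite [RHS]inE /=; apply/solsP/idP => [hY|hY j].
  have : (#|I :&: sd Y Y0| == 1) || (#|I :&: sd Y Y0| == 2) || (#|I :&: sd Y Y0| == 0).
    by rewrite cardI; case: (_ \in _); case: (_ \in _).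
  case/orP => [/orP[->//|/eqP h2]|/eqP h2]; rewrite h2 /=.
    rewrite orbF cardJ; apply/subsetP=> l; rewrite inE => /andP[lI /existsP[j /andP[/eqP sj lj]]].
    by have := hY j; rewrite (key _ _ _ sj (petalE _ _ sj lj lI)) h2 /= orbF.
  rewrite cards_eq0; apply/eqP/setP=> l; rewrite inE in_set0; apply/negbTE.
  apply/negP=> /andP[]; rewrite inE => /andP[lI /existsP[j /andP[/eqP sj lj]]].
  by have := hY j; rewrite (key _ _ _ sj (petalE _ _ sj lj lI)) h2 /= => /negPf ->.
have /orP[/eqP/ok1->//|/eqP sj] := sizeF j.
have /card_gt0P[l /setDP[lj lI]] : 0 < #|(F j).1 :\: I|.
  by rewrite cardsD (setIidPr (core_sub sj)) sj sI.
rewrite (key _ _ _ sj (petalE _ _ sj lj lI)).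
have lJ : l \in petals by rewrite inE lI; apply/existsP; exists j; rewrite sj lj.
case/or3P: hY => [->//|/andP[-> ]|/andP[-> ]].
  by rewrite cardJ => /subsetP/(_ _ lJ) ->; rewrite orbT.
rewrite cards_eq0 => /eqP/setP/(_ l); rewrite inE lJ in_set0 /= => -> /=.
by rewrite !orbT.
Qed.

Lemma sunflower_count : exists n, [/\ 2 <= n <= m, n + 2 <= #|T| &
  2 ^ n.+1 * #|sols F| = (2 ^ n + 1) * 2 ^ #|T|].
Proof.
have dIJ : [disjoint I & petals].
  by rewrite -setI_eq0; apply/eqP/setP=> x; rewrite !inE; case: (x \in _); case: (x \in _).
exists #|petals|; split; first exact: card_petals.
  by rewrite -sI addnC -cardsUI -[_ :&: _]/(I :&: petals) (disjoint_setI0 dIJ) cards0 addn0 max_card.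
have [Y0 hY0 mono] := mono_sol.
have dRs : disj_regions [:: I; petals] by rewrite /= dIJ.
have := masked_region_count Y0 (sunflower_ok #|petals|) dRs.
have -> : [seq #|R : {set T}| | R <- [:: I; petals]] = [:: 2; #|petals|] by rewrite /= sI.
rewrite -(sunflower_sols hY0 mono) wt_sunflower /= addn0 add2n expnS => e.
apply/eqP; rewrite -(eqn_pmul2l (isT : 0 < 2)) mulnA mulnC e.
by rewrite mulnCA [2 ^ _ * _]mulnC.
Qed.

End Sunflower.

(** * Possible numbers of solutions of a homogeneous family *)

Section Values.
Variables (T : finType) (m : nat) (F : 'I_m -> {set T} * {set T}).

(** The fractions are 1, 3/4, 5/8, 35/64, then 9/16, then those of sunflowers. Sunflowers start at
    [n = 4] because two and three petals give 5/8 and 9/16 again. *)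
Definition hom_value s :=
  [\/ [\/ s = 2 ^ #|T|, 4 * s = 3 * 2 ^ #|T|, 8 * s = 5 * 2 ^ #|T| | 64 * s = 35 * 2 ^ #|T|],
      1 < m /\ 16 * s = 9 * 2 ^ #|T| |
      exists n, [/\ 4 <= n <= m, n + 2 <= #|T| & 2 ^ n.+1 * s = (2 ^ n + 1) * 2 ^ #|T|]].

Lemma single_value (w : {set T} * {set T}) :
  small_size #|w.1| -> sols F = [set Y | ok w Y] -> hom_value #|sols F|.
Proof.
move=> sw ->; have := single_count w.
have w3 : wt [:: 3] (fun cs => near_half 3 (head 0 cs)) = 6 by vm_compute.
have w5 : wt [:: 5] (fun cs => near_half 5 (head 0 cs)) = 20 by vm_compute.
have w7 : wt [:: 7] (fun cs => near_half 7 (head 0 cs)) = 70 by vm_compute.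
move: sw; rewrite /small_size !inE => /or3P[] /eqP ->; rewrite ?w3 ?w5 ?w7;
  rewrite -1?[2 ^ 3]/8 -1?[2 ^ 5]/32 -1?[2 ^ 7]/128 => e.
- by constructor 1; constructor 2; lia.
- by constructor 1; constructor 3; lia.
- by constructor 1; constructor 4; lia.
Qed.

Lemma ord_neq_gt1 (j0 j1 : 'I_m) : j0 != j1 -> 1 < m.
Proof. by rewrite -val_eqE /=; have := ltn_ord j0; have := ltn_ord j1; lia. Qed.

(** Singletons impose nothing, and the cases follow the largest support. A 7-set admits no other
    support; a 5-set admits at most one 3-set, inside it. Among 3-sets, two that meet in a pair
    generate a sunflower; two distinct ones that do not exclude any third. *)
Lemma hom_classification :
  (forall j, (#|(F j).1| == 1) || small_size #|(F j).1|) -> large (sols F) ->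
  hom_value #|sols F|.
Proof.
move=> sizeF lF.
have small j : #|(F j).1| != 1 -> small_size #|(F j).1| by have := sizeF j; case: eqP.
have [/existsP[j0 /eqP s0]|no7] := boolP [exists j, #|(F j).1| == 7].
  have m0 : small_size #|(F j0).1| by rewrite s0.
  apply: (single_value m0); apply: sols_single => // j.
  have [->|/small mj] := eqVneq #|(F j).1| 1; [by left | right].
  have le : #|(F j).1| <= #|(F j0).1|.
    by rewrite s0; move: mj; rewrite /small_size !inE => /or3P[] /eqP ->.
  have [_] := pair_large_sets m0 mj le lF (sols_pair F j0 j).
  rewrite s0 /= orbF => /andP[/eqP sj /eqP sI].
  exact/esym/(eq_set_cardI s0 (esym sj) sI).
have [/existsP[j0 /eqP s0]|no5] := boolP [exists j, #|(F j).1| == 5].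
  have m0 : small_size #|(F j0).1| by rewrite s0.
  have dich j : [\/ #|(F j).1| = 1, (F j).1 = (F j0).1 |
      #|(F j).1| = 3 /\ #|(F j0).1 :&: (F j).1| = 3].
    have [->|/small mj] := eqVneq #|(F j).1| 1; first by constructor 1.
    have le : #|(F j).1| <= #|(F j0).1|.
      move: no7; rewrite negb_exists => /forallP/(_ j).
      by rewrite s0; move: mj; rewrite /small_size !inE => /or3P[] /eqP ->.
    have [_] := pair_large_sets m0 mj le lF (sols_pair F j0 j).
    rewrite s0 /= => /orP[/andP[/eqP sj /eqP sI]|/andP[/eqP sj /eqP sI]]; last by constructor 3.
    by constructor 2; apply/esym/(eq_set_cardI s0 (esym sj) sI).
  have [/existsP[j1 /eqP s1]|no3] := boolP [exists j, #|(F j).1| == 3]; last first.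
    apply: (single_value m0); apply: sols_single => // j.
    case: (dich j) => [||[sj _]]; [by left | by right |].
    by move: no3; rewrite negb_exists => /forallP/(_ j); rewrite sj.
  constructor 2; split.
    by apply: (@ord_neq_gt1 j0 j1); apply/eqP=> e; move: s0; rewrite e s1.
  apply: (@sols_double_count _ _ _ lF j0 j1) => [j|]; last first.
    case: (dich j1) => [|e|[_ ->]]; rewrite ?s1 ?s0 //.
    by move: s0; rewrite -e s1.
  case: (dich j) => [||[sj _]]; [by constructor 1 | by constructor 2 | constructor 3].
  have m0' : #|(F j0).1| \in [:: 3; 5] by rewrite s0.
  have := triple_large_sets m0' s1 sj lF (sols_triple F j0 j1 j).
  rewrite s0 /= => /eqP s3.
  apply: esym; apply: (eq_set_cardI s1 sj); apply/eqP; rewrite eqn_leq.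
  rewrite -{1}s1 subset_leq_card ?subsetIl //= -{1}s3 -setIA.
  by rewrite subset_leq_card ?subsetIr.
have size3 j : (#|(F j).1| == 1) || (#|(F j).1| == 3).
  have := sizeF j; rewrite /small_size !inE.
  move: no7 no5; rewrite !negb_exists => /forallP/(_ j)/negPf -> /forallP/(_ j)/negPf ->.
  by rewrite !orbF.
have [/existsP[j0 /eqP s0]|no3] := boolP [exists j, #|(F j).1| == 3]; last first.
  constructor 1; constructor 1; rewrite -cardsT -card_powerset.
  apply: eq_card => Y; rewrite [RHS]inE subsetT; apply/solsP=> j; apply/ok1.
  move: no3; rewrite negb_exists => /forallP/(_ j) n3.
  by have := size3 j; rewrite (negPf n3) orbF => /eqP.
have m0 : small_size #|(F j0).1| by rewrite s0.
have [/existsP[j1 /andP[/eqP s1 ne]]|all0] := 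
    boolP [exists j, (#|(F j).1| == 3) && ((F j).1 != (F j0).1)]; last first.
  apply: (single_value m0); apply: sols_single => // j.
  have /orP[/eqP->|/eqP sj] := size3 j; [by left | right; apply/eqP].
  by move: all0; rewrite negb_exists => /forallP/(_ j); rewrite sj /= negbK.
have j01 : 1 < m by apply: (@ord_neq_gt1 j0 j1); apply: contra ne => /eqP ->.
have I3 : #|(F j0).1 :&: (F j1).1| < 3.
  rewrite ltn_neqAle -{2}s0 subset_leq_card ?subsetIl // andbT.
  apply: contra ne => /eqP sI.
  by rewrite (eq_set_cardI s0 s1 sI).
have [/eqP sI|nI2] := boolP (#|(F j0).1 :&: (F j1).1| == 2).
  have [n [/andP[n2 nm] nT e]] := sunflower_count size3 lF s0 s1 sI.
  have [n4|] := leqP 4 n; first by constructor 3; exists n; rewrite n4 nm.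
  case: n n2 nm {nT} e => [|[|[|[|n]]]] // _ nm e _.
    by constructor 1; constructor 3; move: e; rewrite -[_ * _ * _]/(8 * _); lia.
  by constructor 2; split=> //; move: e; lia.
constructor 2; split=> //.
have I1 : #|(F j0).1 :&: (F j1).1| <= 1 by move: I3 nI2; case: #|_| => [|[|[|]]].
apply: (@sols_double_count _ _ _ lF j0 j1) => [j|]; last by rewrite s0 s1 I1 orbT.
have /orP[/eqP sj|/eqP sj] := size3 j; first by constructor 1.
have m0' : #|(F j0).1| \in [:: 3; 5] by rewrite s0.
have := triple_large_sets m0' s1 sj lF (sols_triple F j0 j1 j).
rewrite s0 /= => /or4P[].
- by move/eqP=> e; move: I1; rewrite e.
- by move/eqP/(eq_set_cardI s0 sj) => e; constructor 2.
- by move/eqP/(eq_set_cardI s1 sj) => e; constructor 3.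
move/eqP=> e; have := subset_leq_card (subsetIl ((F j0).1 :&: (F j1).1) (F j).1).
by rewrite e leqNgt ltnS I1.
Qed.
End Values.

(** * Shape of a single column that keeps more than half of the cube *)

Lemma bin_quarter N j : 9 <= N -> 4 * 'C(N, j) <= 2 ^ N.
Proof.
elim: N j => // N IH j; rewrite leq_eqVlt => /orP[/eqP <-|].
  (* Base case 9: the largest coefficient is 126 and 504 is at most 512, whereas at 8 one has 280
     against 256. Pascal's rule carries the bound upwards. *)
  have h : all (fun i => 4 * 'C(9, i) <= 2 ^ 9) (iota 0 10) by vm_compute.
  have [j9|j9] := leqP j 9; first by apply: (allP h); rewrite mem_iota.
  by rewrite bin_small.
move=> N9; case: j => [|j]; last by have := IH j N9; have := IH j.+1 N9; rewrite binS expnS; lia.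
by have := IH 0 N9; rewrite !bin0 expnS; lia.
Qed.

Lemma bin_large N j : 2 ^ N < 4 * 'C(N, j) -> [&& N <= 8, N <= j.*2.+1 & j.*2 <= N.+1].
Proof.
move=> lt; have N8 : N <= 8.
  by rewrite leqNgt; apply: contraL lt => /(bin_quarter j); rewrite -leqNgt.
have jN : j <= N by rewrite leqNgt; apply: contraL lt => /bin_small ->; rewrite muln0.
have h : all (fun N => all (fun j => (2 ^ N < 4 * 'C(N, j)) ==>
    [&& N <= 8, N <= j.*2.+1 & j.*2 <= N.+1]) (iota 0 9)) (iota 0 9) by vm_compute.
have /allP/(_ N) := h; rewrite mem_iota => /(_ N8)/allP/(_ j).
by rewrite mem_iota lt => /(_ (leq_trans jN N8)).
Qed.

Section Columns.
Variables (R : realType) (k : nat).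
Implicit Types (v : 'I_k -> R) (A B P Q : {set 'I_k}).

Definition col_ok v B := (\sum_(i in B) v i == 0)%R || (\sum_(i in B) v i == 1)%R.

Lemma cube_preimage_cardE m (L : 'M[R]_(k, m)) :
  cube_preimage_card L = #|[set B : {set 'I_k} | [forall j, col_ok (L^~ j) B]]|.
Proof.
pose h (b : {ffun 'I_k -> bool}) := [set i | b i].
have inj_h : injective h.
  by move=> b c /setP e; apply/ffunP=> i; have := e i; rewrite !inE.
rewrite /cube_preimage_card -(card_imset _ inj_h); congr #|pred_of_set _|.
have E (b : {ffun 'I_k -> bool}) j : ((\row_i ((b i : nat)%:R : R)) *m L)%R ord0 j =
    (\sum_(i in h b) L i j)%R.
  rewrite !mxE [RHS]big_mkcond; apply: eq_bigr => i _; rewrite mxE inE.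
  by case: (b i); rewrite ?mul1r ?mul0r.
apply/setP=> B; rewrite [RHS]inE; apply/imsetP/forallP => [[b]|hB].
  by rewrite inE => /forallP hb -> j; have := hb j; rewrite E.
have hE : h [ffun i => i \in B] = B by apply/setP=> i; rewrite inE ffunE.
by exists [ffun i => i \in B] => //; rewrite inE; apply/forallP=> j; rewrite E hE; apply: hB.
Qed.

(* Flipping the [i]-th bit changes the sum by [v i] up to sign. *)
Lemma large_entries v i (SS : {set {set 'I_k}}) : large SS ->
  SS \subset [set B | col_ok v B] -> [|| v i == 0, v i == 1 | v i == -1]%R.
Proof.
move=> lS sub; apply: contraTT lS => nv; rewrite /large -leqNgt.
pose SS' := [set B | sd B [set i] \in SS].
have cS' : #|SS'| = #|SS|.
  rewrite (card_sd (fun B => B \in SS)); congr #|pred_of_set _|.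
  by apply/setP=> B; rewrite inE.
have dis : SS :&: SS' = set0.
  apply/setP=> B; rewrite in_setI [_ \in SS']inE in_set0; apply/negbTE/negP=> /andP[h1 h2].
  have {h1} : col_ok v B by have /subsetP/(_ _ h1) := sub; rewrite inE.
  have {h2} : col_ok v (sd B [set i]) by have /subsetP/(_ _ h2) := sub; rewrite inE.
  have eD (C : {set 'I_k}) : i \notin C ->
      (\sum_(x in sd C [set i]) v x = v i + \sum_(x in C) v x)%R.
    move=> iC; rewrite (bigD1 i) /=; last by rewrite !inE eqxx (negPf iC).
    congr (_ + _)%R; apply: eq_bigl => x; rewrite !inE.
    by case: (eqVneq x i) => [->|]; rewrite ?(negPf iC) ?addbF ?andbT ?andbF.
  wlog iB : B / i \notin B => [th|].
    have [iB|iB] := boolP (i \in B); last exact: th.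
    move=> h1 h2; apply: (th (sd B [set i])); rewrite ?sdK //.
    by rewrite !inE eqxx iB.
  rewrite /col_ok eD //; move: nv; set S := (\sum_(x in B) _)%R.
  rewrite !negb_or => /and3P[n0 n1 n2] h /orP[/eqP e|/eqP e]; move: h; rewrite e.
    by rewrite addr0 (negPf n0) (negPf n1).
  rewrite addr_eq0 (negPf n2) /= -subr_eq0 addrK.
  by rewrite (negPf n0).
have <- : #|{set 'I_k}| = 2 ^ #|'I_k| by rewrite -[in RHS]cardsT -card_powerset powersetT cardsT.
rewrite mul2n -addnn -{2}cS' -cardsUI dis cards0 addn0.
exact: max_card.
Qed.

Lemma signed_col_sum P Q v B :
  (forall i, v i = (i \in P)%:R - (i \in Q)%:R :> R)%R ->
  (\sum_(i in B) v i = #|P :&: B|%:R - #|Q :&: B|%:R :> R)%R.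
Proof.
move=> hv; rewrite (eq_bigr _ (fun i _ => hv i)) sumrB.
have E A : (\sum_(i in B) (i \in A)%:R = #|A :&: B|%:R :> R)%R.
  rewrite -natr_sum; congr (_%:R)%R; rewrite card_indicator big_mkcond.
  by apply: eq_bigr => i _; rewrite inE; case: (i \in A); case: (i \in B).
by rewrite !E.
Qed.

Lemma signed_col_ok P Q v B :
  (forall i, v i = (i \in P)%:R - (i \in Q)%:R :> R)%R ->
  col_ok v B = (#|Q :&: B| <= #|P :&: B| <= #|Q :&: B|.+1).
Proof.
move=> hv; rewrite /col_ok (signed_col_sum _ hv) subr_eq0 subr_eq -[1%R]/(1%:R)%R -natrD.
by rewrite !eqr_nat; lia.
Qed.

(** On [Q] the flipped set counts the points missing from [B], so the trace on [P :|: Q] exceeds the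
    column sum by exactly [#|Q|]. *)
Lemma masked_col_ok P Q v B : [disjoint P & Q] ->
  (forall i, v i = (i \in P)%:R - (i \in Q)%:R :> R)%R ->
  col_ok v B = (#|Q| <= #|(P :|: Q) :&: sd B Q| <= #|Q|.+1).
Proof.
move=> dPQ hv; rewrite (signed_col_ok _ hv).
suff : #|(P :|: Q) :&: sd B Q| + #|Q :&: B| = #|P :&: B| + #|Q| by lia.
rewrite !card_indicator -!big_split; apply: eq_bigr => x _ /=.
move: dPQ; rewrite -setI_eq0 => /eqP/setP/(_ x); rewrite !inE.
by case: (x \in P); case: (x \in Q); case: (x \in B).
Qed.

(** With [s = #|P :|: Q|] and [q = #|Q|], the weight is ['C(s.+1, q.+1)] out of [2 ^ s]. Exceeding
    one half means that this coefficient exceeds a quarter of [2 ^ s.+1], the situation of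
    [bin_large]. *)
Lemma large_col P Q v : [disjoint P & Q] ->
  (forall i, v i = (i \in P)%:R - (i \in Q)%:R :> R)%R ->
  large [set B | col_ok v B] ->
  [&& #|P :|: Q| <= 7, #|P :|: Q| <= (#|Q|.+1).*2 & #|Q|.*2 <= #|P :|: Q|].
Proof.
move=> dPQ hv lv.
have := masked_region_count (Rs := [:: P :|: Q]) Q
  (fun cs => #|Q| <= head 0 cs <= #|Q|.+1) isT.
have -> : [set Y : {set 'I_k} |
      #|Q| <= head 0 [seq #|R0 :&: sd Y Q| | R0 <- [:: P :|: Q]] <= #|Q|.+1] =
   [set B | col_ok v B].
  by apply/setP=> B; rewrite !inE (masked_col_ok _ dPQ hv).
move/large_weight/(_ lv); rewrite [map _ _]/= wt_interval /= addn0 => lt.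
have /bin_large/and3P[]: 2 ^ #|P :|: Q|.+1 < 4 * 'C(#|P :|: Q|.+1, #|Q|.+1).
  by rewrite expnS -[4]/(2 * 2) -mulnA ltn_pmul2l.
move=> {lt lv hv}; rewrite !doubleS; move: #|_| #|_| => a q; lia.
Qed.

End Columns.

(** * Homogenization by an extra coordinate [None] *)

Section Homogenize.
Variable k : nat.
Implicit Types (A B P Q : {set 'I_k}).

Definition lift_set (e : bool) B : {set option 'I_k} :=
  [set x | if x is Some i then i \in B else e].

Lemma card_lift_set e B : #|lift_set e B| = e + #|B|.
Proof.
have injS : injective (@Some 'I_k) by move=> x y [].
rewrite (cardsD1 None) inE -(card_imset B injS); congr (_ + #|pred_of_set _|).
apply/setP=> -[i|]; rewrite !inE /=; last first.
  by apply/esym/negbTE/negP=> /imsetP[].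
by apply/idP/imsetP => [iB|[j jB [->]]//]; exists i.
Qed.

Lemma lift_setI e1 e2 A B : lift_set e1 A :&: lift_set e2 B = lift_set (e1 && e2) (A :&: B).
Proof. by apply/setP=> -[i|]; rewrite !inE. Qed.

Lemma lift_set_sd e1 e2 A B : sd (lift_set e1 A) (lift_set e2 B) = lift_set (e1 (+) e2) (sd A B).
Proof. by apply/setP=> -[i|]; rewrite !inE. Qed.

(* The constraint [|Q| <= c <= |Q| + 1] on [c = #|(P :|: Q) :&: sd B Q|] is
   centred by adding, when [#|P :|: Q|] is even, one coordinate to its
   support, whose sign makes it contribute [0] or [1] according to whether
   [#|P| = #|Q|] or [#|P| = #|Q| + 2]. *)
Definition homogenize P Q : {set option 'I_k} * {set option 'I_k} :=
  (lift_set (~~ odd #|P :|: Q|) (P :|: Q), lift_set (#|P :|: Q| == #|Q|.*2.+2) Q).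

Lemma homogenize_ok P Q B :
  #|P :|: Q| <= (#|Q|.+1).*2 -> #|Q|.*2 <= #|P :|: Q| ->
  ok (homogenize P Q) (lift_set false B) = (#|Q| <= #|(P :|: Q) :&: sd B Q| <= #|Q|.+1).
Proof.
rewrite /ok /homogenize /= lift_set_sd lift_setI !card_lift_set /near_half /=.
move: #|(P :|: Q) :&: _| #|P :|: Q| #|Q| => c s q.
rewrite doubleS => h1 h2.
(* The bounds leave three cases: the odd one is already centred, and in the two even ones the extra
   coordinate contributes 0 or 1. *)
have : [|| s == q.*2, s == q.*2.+1 | s == q.*2.+2] by lia.
have n0 : (q.*2 == q.*2.+2) = false by lia.
by case/or3P => /eqP ->; rewrite /= ?odd_double /= ?n0 ?eqxx ?add0n ?add1n /= ?uphalf_double ?doubleK.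
Qed.

Lemma homogenize_odd P Q : odd #|(homogenize P Q).1|.
Proof. by rewrite /= card_lift_set oddD oddb addNb addbb. Qed.

Lemma okCr (T : finType) (w : {set T} * {set T}) Y : odd #|w.1| -> ok w (~: Y) = ok w Y.
Proof.
case: w => D G /= oD; rewrite -[RHS](okC G Y oD) /ok /=.
congr (near_half _ #|D :&: _|); apply/setP=> x; rewrite !inE.
by case: (x \in Y); case: (x \in G).
Qed.

(* Homogeneous constraints are invariant under complement. *)
Lemma sols_homogenize m (F : 'I_m -> {set option 'I_k} * {set option 'I_k}) :
  (forall j, odd #|(F j).1|) ->
  #|sols F| = 2 * #|[set B | lift_set false B \in sols F]|.
Proof.
move=> oF; pose S0 := [set Y in sols F | None \notin Y].
have solsC Y : (~: Y \in sols F) = (Y \in sols F).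
  by rewrite !inE; apply: eq_forallb => j; rewrite okCr.
have eS : #|S0| = #|[set B | lift_set false B \in sols F]|.
  have inj_l : injective (lift_set false).
    by move=> B C /setP e; apply/setP=> i; have := e (Some i); rewrite !inE.
  rewrite -(card_imset _ inj_l); congr #|pred_of_set _|; apply/setP=> Y.
  rewrite [LHS]in_set; apply/andP/imsetP => [[hY nY]|[B]].
    have eY : lift_set false [set i | Some i \in Y] = Y.
      by apply/setP=> -[i|]; rewrite !inE ?(negPf nY).
    by exists [set i | Some i \in Y] => //; rewrite inE eY.
  by rewrite inE => hB ->; split => //; rewrite inE.
(* Solutions are split according to whether they contain [None]; complementation exchanges the two
   halves. *)
rewrite -eS mul2n -addnn -(cardsID [set Y : {set option 'I_k} | None \notin Y] (sols F)).
congr (_ + _).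
  by apply: eq_card => Y; rewrite !inE.
rewrite -(card_imset _ (@setC_inj _)); apply: eq_card => Y; rewrite [RHS]in_set.
apply/imsetP/andP => [[Z]|[hY nY]].
  by rewrite in_setD inE negbK => /andP[nZ hZ] ->; rewrite solsC in_setC nZ.
by exists (~: Y); rewrite ?setCK // in_setD inE negbK in_setC nY solsC.
Qed.

End Homogenize.

(** * Values attained by matrices, and explicit matrices for each value *)

Section Values.
Variables (R : realType) (k m : nat).

(** Homogenizing every column doubles both the solutions and the ambient cube, so the fraction is
    preserved and the classification applies on [option 'I_k]. *)
Lemma large_matrix_value (L : 'M[R]_(k, m)) : 2 ^ k < 2 * cube_preimage_card L ->
  hom_value (option 'I_k) m (2 * cube_preimage_card L).
Proof.
rewrite cube_preimage_cardE; set SS := [set B | _] => lt.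
have lS : large SS by rewrite /large card_ord.
have subj j : SS \subset [set B | col_ok (L^~ j) B].
  by apply/subsetP=> B; rewrite !inE => /forallP.
pose P j := [set i | L i j == 1%R]; pose Q j := [set i | L i j == (-1)%R].
have n11 : (1 == -1 :> R)%R = false.
  by apply/negbTE; rewrite -subr_eq0 opprK -[(1 + 1)%R]/(2%:R)%R pnatr_eq0.
have dPQ j : [disjoint P j & Q j].
  rewrite -setI_eq0; apply/eqP/setP=> i; rewrite !inE.
  by case: (eqVneq (L i j) 1%R) => [->|//]; rewrite n11.
have hv j i : (L i j = (i \in P j)%:R - (i \in Q j)%:R)%R.
  rewrite !inE; have /or3P[] := large_entries i lS (subj j); move/eqP=> ->.
  - by rewrite [(0 == 1)%R]eq_sym oner_eq0 [(0 == -1)%R]eq_sym oppr_eq0 oner_eq0 subr0.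
  - by rewrite eqxx n11 subr0.
  - by rewrite eqxx eq_sym n11 sub0r.
have lc j := large_col (dPQ j) (hv j) (largeS (subj j) lS).
pose F j := homogenize (P j) (Q j).
have eS : SS = [set B | lift_set false B \in sols F].
  apply/setP=> B; rewrite !inE; apply: eq_forallb => j.
  by have /and3P[_ h1 h2] := lc j; rewrite homogenize_ok // (masked_col_ok B (dPQ j) (hv j)).
have cS : #|sols F| = 2 * #|SS| by rewrite eS; apply: sols_homogenize => j; apply: homogenize_odd.
rewrite -cS; apply: hom_classification => [j|].
  (* The extra point joins the support only when its size is even, hence at most 6, so 7 is never
     exceeded. *)
  have /and3P[h7 _ _] := lc j; have := homogenize_odd (P j) (Q j).
  rewrite -/(F j); have : #|(F j).1| <= 7.
    rewrite card_lift_set; case: (boolP (odd _)) => //= ev; rewrite add1n ltn_neqAle h7 andbT.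
    by apply: contra ev => /eqP ->.
  by rewrite /small_size !inE; move: #|_| => [|[|[|[|[|[|[|[|]]]]]]]].
by rewrite /large cS card_option card_ord expnS ltn_pmul2l.
Qed.

(** With entries given by indicator differences of [P j] and [Q j], finding a matrix for a value
    amounts to evaluating one weight. *)
Lemma realize (P Q : 'I_m -> {set 'I_k}) (Rs : seq {set 'I_k}) p n v :
  disj_regions Rs -> sumn [seq #|A : {set 'I_k}| | A <- Rs] = n ->
  wt [seq #|A : {set 'I_k}| | A <- Rs] p = v ->
  (forall B, [forall j, #|Q j :&: B| <= #|P j :&: B| <= #|Q j :&: B|.+1] =
     p [seq #|A :&: B| | A : {set 'I_k} <- Rs]) ->
  exists L : 'M[R]_(k, m), cube_preimage_card L * 2 ^ n = 2 ^ k * v.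
Proof.
move=> dRs en ev h; exists (\matrix_(i, j) ((i \in P j)%:R - (i \in Q j)%:R))%R.
rewrite cube_preimage_cardE -en -ev; have := region_count p dRs; rewrite card_ord => <-.
congr (_ * _).
apply: eq_card => B; rewrite !inE -h; apply: eq_forallb => j.
by rewrite (@signed_col_ok _ _ (P j) (Q j)) // => i; rewrite mxE.
Qed.

Definition seg a b : {set 'I_k} := [set i : 'I_k | a <= i < b].

Lemma card_seg a b : b <= k -> #|seg a b| = b - a.
Proof.
move=> bk; rewrite card_indicator.
rewrite (eq_bigr (fun i : 'I_k => (a <= i < b) : nat)) => [|i _]; last by rewrite inE.
have -> n : \sum_(i < n) (a <= i < b : nat) = minn n b - a; last by lia.
by elim: n => [|n IH]; rewrite ?big_ord0 ?big_ord_recr /= ?IH; lia.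
Qed.

Lemma seg_disjoint a b c d : b <= c -> [disjoint seg a b & seg c d].
Proof.
move=> bc; rewrite -setI_eq0; apply/eqP/setP=> i; rewrite !inE.
by apply/negbTE; lia.
Qed.

Lemma card_seg_le a b (B : {set 'I_k}) : b <= k -> #|seg a b :&: B| <= b - a.
Proof. by move=> bk; rewrite -(card_seg a bk) subset_leq_card ?subsetIl. Qed.


(** The fractions of [hom_value] with [2 ^ k] as total; for instance 35/64 is 1/2 + 1/32 + 1/64. The
    bound [n <= k - 1] is the room for [n] petals and a core pair among [k + 1] homogeneous
    coordinates. *)
Definition plus_value s :=
  [\/ [\/ s = 2 ^ (k - 1) + 2 ^ (k - 5) + 2 ^ (k - 6), s = 2 ^ (k - 1) + 2 ^ (k - 3),
         s = 2 ^ (k - 1) + 2 ^ (k - 2) | s = 2 ^ k],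
      1 < m /\ s = 2 ^ (k - 1) + 2 ^ (k - 4) |
      exists n, [/\ 4 <= n <= m, n <= k - 1 & s = 2 ^ (k - 1) + 2 ^ (k - (n + 1))]].

Hypotheses (k6 : 6 <= k) (m0 : 0 < m).

Lemma expn_sub r : r <= k -> 2 ^ (k - r) * 2 ^ r = 2 ^ k.
Proof. by move=> rk; rewrite -expnD subnK. Qed.

Lemma hom_plus_value s : hom_value (option 'I_k) m (2 * s) -> plus_value s.
Proof.
rewrite /hom_value card_option card_ord expnS.
have h1 := expn_sub (leq_trans (isT : 1 <= 6) k6); have h2 := expn_sub (leq_trans (isT : 2 <= 6) k6).
have h3 := expn_sub (leq_trans (isT : 3 <= 6) k6); have h4 := expn_sub (leq_trans (isT : 4 <= 6) k6).
have h5 := expn_sub (leq_trans (isT : 5 <= 6) k6); have h6 := expn_sub k6.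
case=> [[] e|[m1 e]|[n [/andP[n4 nm] nk]]].
- by constructor 1; constructor 4; lia.
- by constructor 1; constructor 3; lia.
- by constructor 1; constructor 2; lia.
- by constructor 1; constructor 1; lia.
- by constructor 2; split=> //; lia.
move=> e; constructor 3; exists n; split; rewrite ?n4 //; first by lia.
have hn : n + 1 <= k by lia.
apply/eqP; rewrite -(eqn_pmul2r (expn_gt0 2 (n + 1))) mulnDl expn_sub // -h1 (addn1 n).
by rewrite [2 ^ n.+1]expnS in e *; apply/eqP; nia.
Qed.

Lemma plus_value_gt s : plus_value s -> 2 ^ (k - 1) < s.
Proof.
have e1 : 2 ^ k = 2 * 2 ^ (k - 1) by rewrite -expnS subn1 prednK // (leq_trans _ k6).
have e0 r : 0 < 2 ^ r by rewrite expn_gt0.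
case=> [[] ->|[_ ->]|[n [_ _ ->]]].
all: by rewrite ?e1 -?addnA -?[in X in _ < X]mul2n -?addnn -[X in X < _]addn0 ltn_add2l ?addn_gt0 ?e0.
Qed.

Lemma realize_plus_value s : plus_value s ->
  exists L : 'M[R]_(k, m), cube_preimage_card L = s.
Proof.
have h1 := expn_sub (leq_trans (isT : 1 <= 6) k6); have h2 := expn_sub (leq_trans (isT : 2 <= 6) k6).
have h3 := expn_sub (leq_trans (isT : 3 <= 6) k6); have h4 := expn_sub (leq_trans (isT : 4 <= 6) k6).
have h5 := expn_sub (leq_trans (isT : 5 <= 6) k6); have h6 := expn_sub k6.
(* All columns but the first are zero, and a zero column is satisfied by every point. *)
pose col0 (A : {set 'I_k}) (j : 'I_m) := if j == 0 :> nat then A else set0.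
have one A B p : (forall C, (#|B :&: C| <= #|A :&: C| <= #|B :&: C|.+1) = p C) ->
   forall C, [forall j, #|col0 B j :&: C| <= #|col0 A j :&: C| <= #|col0 B j :&: C|.+1] = p C.
  move=> h C; rewrite -h; apply/forallP/idP => [/(_ (Ordinal m0))//|hC j].
  by rewrite /col0; case: eqP => // _; rewrite !set0I cards0.
case=> [[] ->|[m1 ->]|[n [/andP[n4 nm] nk ->]]].
(* Three entries 1 and three entries -1: ['C(7, 4) = 35] points out of 64. *)
- have [|||B|L e] := @realize (col0 (seg 0 3)) (col0 (seg 3 6)) [:: seg 0 3; seg 3 6]
    (fun cs => if cs is [:: a; b] then b <= a <= b.+1 else false) 6 35.
  + by rewrite /= seg_disjoint.
  + by rewrite /= !card_seg //; lia.
  + by rewrite /= !card_seg //; lia.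
  + exact: (one (seg 0 3) (seg 3 6) _ (fun C => erefl)).
  by exists L; lia.
(* Two entries 1 and two entries -1: ['C(5, 3) = 10] points out of 16. *)
- have [|||B|L e] := @realize (col0 (seg 0 2)) (col0 (seg 2 4)) [:: seg 0 2; seg 2 4]
    (fun cs => if cs is [:: a; b] then b <= a <= b.+1 else false) 4 10.
  + by rewrite /= seg_disjoint.
  + by rewrite /= !card_seg //; lia.
  + by rewrite /= !card_seg //; lia.
  + exact: (one (seg 0 2) (seg 2 4) _ (fun C => erefl)).
  by exists L; lia.
- have [|||B|L e] := @realize (col0 (seg 0 2)) (col0 set0) [:: seg 0 2]
    (fun cs => if cs is [:: a] then a <= 1 else false) 2 3.
  + by [].
  + by rewrite /= !card_seg //; lia.
  + by rewrite /= !card_seg //; lia.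
  + by apply: (one _ _ (fun C => #|seg 0 2 :&: C| <= 1)) => C; rewrite set0I cards0.
  by exists L; lia.
- have [|||B|L e] := @realize (col0 set0) (col0 set0) [::] (fun=> true) 0 1 => //.
    by apply: (one _ _ (fun=> true)) => C; rewrite set0I cards0.
  by exists L; lia.
(* Two columns with disjoint pairs of entries 1: 3/4 squared is 9/16. *)
- pose P (j : 'I_m) := if j == 0 :> nat then seg 0 2 else if j == 1 :> nat then seg 2 4 else set0.
  have [|||B|L e] := @realize P (fun=> set0) [:: seg 0 2; seg 2 4]
    (fun cs => if cs is [:: a; b] then (a <= 1) && (b <= 1) else false) 4 9.
  + by rewrite /= seg_disjoint.
  + by rewrite /= !card_seg //; lia.
  + by rewrite /= !card_seg //; lia.
  + apply/forallP/andP => [h|[hA hB] j].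
      by have := h (Ordinal m0); have := h (Ordinal m1); rewrite /P /= set0I cards0.
    by rewrite set0I cards0 /P; do 2?case: eqP => // _; rewrite set0I cards0.
  by exists L; lia.
(* Column [j] is the edge from the centre 0 to the leaf [j.+1] of a star with [n] leaves; the
   solutions are its independent sets, [2 ^ n + 1] out of [2 ^ n.+1]. *)
pose P (j : 'I_m) := if j < n then seg 0 1 :|: seg j.+1 j.+2 else set0.
have [|||B|L e] := @realize P (fun=> set0) [:: seg 0 1; seg 1 n.+1]
    spokes_ok n.+1 (2 ^ n + 1).
+ by rewrite /= seg_disjoint.
+ by rewrite /= !card_seg //; lia.
+ by rewrite [map _ _]/= !card_seg ?subn0 ?subn1 ?wt_spokes //; lia.
+ apply/forallP/orP => [h|h j].
    have [h0|/card_gt0P[x /setIP[x0 xB]]] := posnP #|seg 0 1 :&: B|; first by left; apply/eqP.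
    have [h0|/card_gt0P[y /setIP[y1 yB]]] := posnP #|seg 1 n.+1 :&: B|; first by right; apply/eqP.
    move: x0 y1; rewrite !inE => /andP[_ x0] /andP[y1 yn].
    have ym : y.-1 < m by lia.
    have := h (Ordinal ym); rewrite set0I cards0 /P /= ifT; last by lia.
    have sub : [set x; y] \subset (seg 0 1 :|: seg y.-1.+1 y.-1.+2) :&: B.
      by apply/subsetP=> z /set2P[] ->; rewrite !inE ?xB ?yB andbT; lia.
    have := subset_leq_card sub; rewrite cards2 -val_eqE /=; case: eqP => [exy|_ /= hle]; last by lia.
    by exfalso; lia.
  rewrite set0I cards0 /P; case: ltnP => // jn; last by rewrite set0I cards0.
  rewrite setIUl; apply: leq_trans (leq_card_setU _ _) _.
  case: h => /eqP h; first by rewrite h; apply: leq_trans (card_seg_le _ _ _) _; lia.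
  have sub : seg j.+1 j.+2 :&: B \subset seg 1 n.+1 :&: B.
    by apply: setSI; apply/subsetP=> z; rewrite !inE; lia.
  have := subset_leq_card sub; rewrite h leqn0 => /eqP ->.
  by rewrite addn0; apply: leq_trans (card_seg_le _ _ _) _; lia.
exists L; apply/eqP; rewrite -(eqn_pmul2r (expn_gt0 2 n.+1)) e mulnDl (addn1 n).
rewrite (expn_sub (r := n.+1)); last by lia.
by rewrite -h1 [2 ^ n.+1]expnS; apply/eqP; nia.
Qed.

End Values.

(** * The description of the sets as the number of columns grows *)

Lemma HplusE (R : realType) k m s : 6 <= k -> 0 < m ->
  Hplus R (k + m) k s <-> plus_value k m s.
Proof.
move=> k6 m0; rewrite /Hplus /Hset addKn.
have k1 : 2 ^ k = 2 * 2 ^ (k - 1) by rewrite -expnS subn1 prednK // (leq_trans _ k6).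
split=> [[[L <-] ns]|vs].
  apply: hom_plus_value => //; apply: large_matrix_value; rewrite k1 ltn_pmul2l // ltnNge.
  apply/negP=> le; apply: ns; rewrite le andbT.
  (* The origin is always counted, so the count is at least 1 and the excluded range removes every
     count up to one half. *)
  rewrite cube_preimage_cardE; apply/card_gt0P; exists set0; rewrite inE.
  by apply/forallP=> j; rewrite /col_ok big_set0 eqxx.
split; first exact: (realize_plus_value _ k6 m0 vs).
by have := plus_value_gt k6 vs; rewrite ltnNge => /negP h /andP[_ /h].
Qed.

Lemma plus_value_mono k m m' s : m <= m' -> plus_value k m s -> plus_value k m' s.
Proof.
move=> mm [h|[m1 e]|[n [/andP[n4 nm] nk e]]].
- by constructor 1.
- by constructor 2; split=> //; apply: leq_trans mm.
- by constructor 3; exists n; rewrite n4 (leq_trans nm mm).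
Qed.

Theorem theorem3p4 (R : realType) (k : nat) (hk : (6 <= k)%N) :
  (forall s : nat, Hplus R (k + 1) k s <->
     (s = 2 ^ (k - 1) + 2 ^ (k - 5) + 2 ^ (k - 6) \/ s = 2 ^ (k - 1) + 2 ^ (k - 3)
      \/ s = 2 ^ (k - 1) + 2 ^ (k - 2) \/ s = 2 ^ k)%N) /\
  (forall s : nat, Hplus R (k + 2) k s <->
     (Hplus R (k + 1) k s \/ s = 2 ^ (k - 1) + 2 ^ (k - 4))%N) /\
  (forall i : nat, (3 <= i <= k - 1)%N -> forall s : nat,
     Hplus R (k + i) k s <->
     (Hplus R (k + i - 1) k s \/ s = 2 ^ (k - 1) + 2 ^ (k - (i + 1)))%N) /\
  (forall i : nat, (k <= i)%N -> forall s : nat,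
     Hplus R (k + i) k s <-> Hplus R (2 * k - 1) k s).
Proof.
have no_spokes n m : 4 <= n <= m -> m < 4 -> False by lia.
split; last split; last split.
- move=> s; rewrite HplusE //; split=> [[[]|[//]|[n [/no_spokes h _ _]]]|]; try tauto.
    by case: (h isT).
  by move=> h; constructor 1; case: h => [->|[->|[->|->]]];
    [constructor 1|constructor 2|constructor 3|constructor 4].
- move=> s; rewrite !HplusE //; split=> [[h|[_ ->]|[n [/no_spokes h _ _]]]|[|->]].
  + by left; constructor 1.
  + by right.
  + by case: (h isT).
  + exact: plus_value_mono.
  + by constructor 2.
- move=> i /andP[i3 ik] s; rewrite -addnBA; last by lia.
  rewrite !HplusE //; try lia.
  split=> [[h|[_ ->]|[n [/andP[n4 ni] nk ->]]]|[|->]].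
  + by left; constructor 1.
  + by left; constructor 2; split=> //; lia.
  + have [->|ne] := eqVneq n i; [by right | left; constructor 3; exists n; split=> //].
    by rewrite n4; lia.
  + by apply: plus_value_mono; lia.
  + have [i4|i4] := leqP 4 i; first by constructor 3; exists i; rewrite i4 leqnn.
    (* For [i = 3] the new value is [2 ^ (k - 1) + 2 ^ (k - 4)], the 9/16 case. *)
    by have -> : i = 3 by [lia]; constructor 2.
(* From [k - 1] columns on, the bound [n <= k - 1] is the binding one, so further columns bring no
   new value. *)
move=> i ki s; have -> : 2 * k - 1 = k + (k - 1) by lia.
rewrite !HplusE //; try lia.
split=> [[h|[_ ->]|[n [/andP[n4 ni] nk ->]]]|].
- by constructor 1.
- by constructor 2; split=> //; lia.
- by constructor 3; exists n; rewrite n4.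
- by apply: plus_value_mono; lia.
Qed.
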